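(* Let $\Gamma$ be a finite connected network and let $h:\Gamma\to\mathbb{R}$ be continuous with $h\not\equiv 0$. Then the problem $$\begin{cases}\partial^2 u=-he^u & \text{on } e_j,\ j\in J,\\ u_j(v_i)=u_k(v_i) & j,k\in Inc_i,\ v_i\in V,\\ \sum_{j\in Inc_i}\partial_j u(v_i)=0 & v_i\in V,\end{cases}$$ (that is, the Kazdan-Warner problem on $\Gamma$ with $c=0$) has a solution $u$ if and only if $h$ changes sign and $\int_\Gamma h\,dx<0$.
   Context: Network: $\Gamma=(V,E)$ consists of a finite collection of points (vertices) $V=\{v_i\}_{i\in I}\subset\mathbb{R}^n$ connected by a finite collection of continuous non-self-intersecting edges $E=\{e_j\}_{j\in J}$ ($J\neq\emptyset$), where any two edges can intersect only at a vertex. Each edge is parametrized by a continuous injective map $\pi_j:[0,l_j]\to\mathbb{R}^n$, $l_j>0$, whose endpoints $\pi_j(0),\pi_j(l_j)$ are vertices, with $e_j=\pi_j((0,l_j))$ containing no vertex. $\Gamma$ is assumed connected. $Inc_i=\{j\in J: e_j\text{ is incident to }v_i\}$. For $u:\Gamma\to\mathbb{R}$, $u_j:[0,l_j]\to\mathbb{R}$ denotes the restriction of $u$ to edge $j$ in the coordinate $y=\pi_j^{-1}(x)$, and $u_j(v_i)$ means $u_j(\pi_j^{-1}(v_i))$. Derivatives $\partial u,\partial^2u$ on an edge are with respect to the coordinate $y\in(0,l_j)$. At a vertex $v_i$ and $j\in Inc_i$, the oriented derivative is $\partial_j u(v_i)=\lim_{x\in e_j,\,x\to v_i}\frac{u_j(\pi_j^{-1}(x))-u_j(\pi_j^{-1}(v_i))}{|\pi_j^{-1}(x)-\pi_j^{-1}(v_i)|}$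 (derivative pointing from the vertex into the edge). $\int_\Gamma\phi\,dx=\sum_{j\in J}\int_0^{l_j}\phi_j(r)\,dr$. $u$ is continuous on $\Gamma$ if each $u_j\in C([0,l_j])$ and $u_j(v_i)=u_k(v_i)$ for all $i\in I$, $j,k\in Inc_i$. $C^2(\Gamma)$ is the space of continuous functions on $\Gamma$ with $u_j\in C^2([0,l_j])$ for every $j$. A solution of the problem is a function $u\in C^2(\Gamma)$ satisfying it pointwise (strong solution). *)

(* Defs.v *)
From HB Require Import structures.
From mathcomp Require Import all_boot all_order all_algebra.
From mathcomp Require Import all_classical all_reals all_analysis.

Set Implicit Arguments.
Unset Strict Implicit.
Unset Printing Implicit Defensive.

Import Order.TTheory GRing.Theory Num.Theory.
Import numFieldNormedType.Exports.

Local Open Scope classical_set_scope.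
Local Open Scope ring_scope.

(* Connectedness is not a field: it is a property of [network_support], below.
   The enumeration [vert] of the vertices need not be injective; incidence is
   defined through points, so listing a vertex twice changes nothing.
   Injectivity of [par j] on the closed interval excludes loops, but multiple
   edges between two vertices are allowed. *)
Record network (R : realType) (n : nat) := Network {
  vertex : finType;
  edge : finType;
  vert : vertex -> 'rV[R]_n;
  len : edge -> R;
  par : edge -> R -> 'rV[R]_n;
  edge_nonempty : (0 < #|edge|)%N;
  len_gt0 : forall j, 0 < len j;
  par_continuous : forall j, {within `[0, len j], continuous (par j)};
  par_injective : forall j, {in `[0, len j]%classic &, injective (par j)};
  par_start : forall j, range vert (par j 0);
  par_end : forall j, range vert (par j (len j));
  par_interior : forall j y, 0 < y < len j -> ~ range vert (par j y);
  edges_meet_at_vertices : forall j k, j != k ->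
    (par j @` `[0, len j]) `&` (par k @` `[0, len k]) `<=` range vert
}.

Section Network.
Variables (R : realType) (n : nat) (G : network R n).
Implicit Types (i : vertex G) (j k : edge G) (u h : 'rV[R]_n -> R).

Definition edge_set j : set 'rV[R]_n := par j @` `]0, len j[.

Definition network_support : set 'rV[R]_n :=
  range (@vert R n G) `|` \bigcup_(j in [set: edge G]) edge_set j.

Definition incident i j : bool :=
  (vert i == par j 0) || (vert i == par j (len j)).

(* The inverse of the parametrization, meaningful on the closed edge. *)
Definition edge_coord j : 'rV[R]_n -> R := 'pinv_(fun=> 0) `[0, len j] (par j).

(* Functions on the network are total functions on R^n; all the notions below
   depend only on their values on [network_support]. *)
Definition on_edge u j : R -> R := fun y => u (par j y).

Definition vertex_value u j i : R := on_edge u j (edge_coord j (vert i)).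

Definition oriented_derivative u j i : R :=
  lim ((on_edge u j (edge_coord j x) - vertex_value u j i)
         / `|edge_coord j x - edge_coord j (vert i)|
       @[x --> within (edge_set j) (nbhs (vert i))]).

Definition network_integral u : R :=
  \sum_(j : edge G) \int[lebesgue_measure]_(r in `[0, len j]) on_edge u j r.

Definition vertex_compatible u : Prop :=
  forall i j k, incident i j -> incident i k ->
    vertex_value u j i = vertex_value u k i.

Definition network_continuous u : Prop :=
  (forall j, {within `[0, len j], continuous (on_edge u j)}) /\
  vertex_compatible u.

(* C^2([a, b]): f is continuous on [a, b], twice differentiable on ]a, b[, and
   f', f'' extend continuously to [a, b] (the extensions being f1 and f2). *)
Definition C2_segment (a b : R) (f : R -> R) : Prop :=
  exists f1 f2 : R -> R,
    [/\ {within `[a, b], continuous f},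
        {within `[a, b], continuous f1},
        {within `[a, b], continuous f2},
        (forall y, a < y < b -> is_derive y 1 f (f1 y)) &
        (forall y, a < y < b -> is_derive y 1 f1 (f2 y))].

Definition network_C2 u : Prop :=
  network_continuous u /\ forall j, C2_segment 0 (len j) (on_edge u j).

(* For u in C^2, every limit [oriented_derivative u j i] with j incident to i
   exists, so the total operator [lim] is not used outside its domain. *)
Definition kazdan_warner0_solution h u : Prop :=
  [/\ network_C2 u,
      (forall j y, 0 < y < len j ->
         (on_edge u j)^`(2)%classic y = - (on_edge h j y * expR (on_edge u j y))),
      vertex_compatible u &
      (forall i, \sum_(j | incident i j) oriented_derivative u j i = 0)].

Definition changes_sign h : Prop :=
  (exists2 x, network_support x & 0 < h x) /\
  (exists2 x, network_support x & h x < 0).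

End Network.

(* Main.v *)
Require Import Defs.
From HB Require Import structures.
From mathcomp Require Import all_boot all_order all_algebra.
From mathcomp Require Import all_classical all_reals all_analysis.
From mathcomp Require Import ring lra.

Set Implicit Arguments.
Unset Strict Implicit.
Unset Printing Implicit Defensive.

Import Order.TTheory GRing.Theory Num.Theory.
Import numFieldNormedType.Exports.

Local Open Scope classical_set_scope.
Local Open Scope ring_scope.

(** The network is first reduced to a metric graph whose vertices are the points
    where edges end.  The edges are segments, and functions on them are extended
    to the whole line, so that integrals and derivatives are those of functions
    continuous on the line.

    Necessity.  Integrating the equation over the graph, Kirchhoff's law gives
    that the integral of h exp(u) vanishes; since h is not zero it takes both
    signs ([rhs_pos], [rhs_neg]).  Multiplying by exp(-u) and integrating by
    parts, the integral of h is minus that of (u')^2 exp(-u), which is negative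
    since u' = 0 would force h = 0 ([graph_integral_coef_lt0]).

    Sufficiency.  One minimises the energy, the integral of (u')^2, over the C^2
    functions u such that the integral of h exp(u) is nonnegative.  The class is
    not empty, because h is positive somewhere ([feasible]).  The infimum need
    not be attained in this class, and is not needed: a minimizing sequence u_n,
    normalised at a vertex, is equicontinuous, and bounded by connectedness, so
    it converges uniformly to some continuous w along an ultrafilter
    ([energy_compactness]).  If the integral of h exp(w) phi is positive, then
    u_n + t phi is admissible for small t > 0 and n large, so that its energy is
    at least the infimum.  Expanding in t and integrating u_n' phi' by parts,
    one can let n tend to infinity, and then t to 0: the limit of the integrals
    of u_n' phi' is nonnegative.  A linear form that is nonnegative where
    another one is positive is a nonnegative multiple of it ([lagrange_multiplier]), so
    w is a very weak solution of - w'' = mu h exp(w) with Kirchhoff conditions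
    ([weak_solution]).  Comparing w with the solution of the Dirichlet problem
    on each edge shows that w is of class C^2 and satisfies Kirchhoff's law
    ([weak_solution_regular]).  If mu were 0, w would be constant, and the
    integral of h exp(w) would be negative with that of h; hence mu > 0
    ([multiplier_gt0]), and w + ln mu is a solution. *)

(** * Calculus on the line *)

Section Calculus.
Variable R : realType.
Implicit Types (f g F G : R -> R) (a b c x y l : R).

Lemma is_derive_addf f g x a b : is_derive x 1 f a -> is_derive x 1 g b ->
  is_derive x 1 (fun y => f y + g y) (a + b).
Proof. exact: is_deriveD. Qed.

Lemma is_derive_oppf f x a : is_derive x 1 f a ->
  is_derive x 1 (fun y => - f y) (- a).
Proof. exact: is_deriveN. Qed.

Lemma is_derive_subc f x c a : is_derive x 1 f a ->
  is_derive x 1 (fun y => f y - c) a.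
Proof.
move=> fa; rewrite -[a]addr0; exact: is_derive_addf.
Qed.

Lemma is_derive_mulf f g x a b : is_derive x 1 f a -> is_derive x 1 g b ->
  is_derive x 1 (fun y => f y * g y) (a * g x + f x * b).
Proof.
move=> fa gb; apply: (@is_derive_eq _ _ _ _ _ _ _ _ (is_deriveM fa gb)).
by rewrite /GRing.scale /= addrC mulrC; congr (_ + _); rewrite mulrC.
Qed.

Lemma is_derive_scalef f x c a : is_derive x 1 f a ->
  is_derive x 1 (fun y => c * f y) (c * a).
Proof. exact: is_deriveZ. Qed.

Lemma is_derive_expf f x a : is_derive x 1 f a ->
  is_derive x 1 (fun y => expR (f y)) (a * expR (f x)).
Proof.
move=> fa; have := @is_derive1_comp _ expR f x _ _ (is_derive_expR (f x)) fa.
by rewrite mulrC.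
Qed.

Lemma is_derive_continuous f x a : is_derive x 1 f a -> {for x, continuous f}.
Proof.
by move=> [df _]; apply/differentiable_continuous/derivable1_diffP.
Qed.

Lemma continuous_addf f g : continuous f -> continuous g ->
  continuous (fun y => f y + g y).
Proof. by move=> cf cg x; apply: continuousD; [exact: cf|exact: cg]. Qed.

Lemma continuous_oppf f : continuous f -> continuous (fun y => - f y).
Proof. by move=> cf x; apply: continuousN; exact: cf. Qed.

Lemma continuous_mulf f g : continuous f -> continuous g ->
  continuous (fun y => f y * g y).
Proof. by move=> cf cg x; apply: continuousM; [exact: cf|exact: cg]. Qed.

Lemma continuous_scalef c f : continuous f -> continuous (fun y => c * f y).
Proof. by move=> cf; apply: continuous_mulf => // x; exact: cvg_cst. Qed.

Lemma continuous_expf f : continuous f -> continuous (fun y => expR (f y)).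
Proof.
by move=> cf x; apply: continuous_comp; [exact: cf|exact: continuous_expR].
Qed.

(** The retraction of the line onto the segment [0, l]; composing with it turns
    a function continuous on the segment into one continuous everywhere. *)
Definition clamp l x : R := Num.max 0 (Num.min x l).

Lemma clamp_ge0 l x : 0 <= clamp l x.
Proof. by rewrite /clamp le_max lexx. Qed.

Lemma clamp_le l x : 0 <= l -> clamp l x <= l.
Proof. by move=> l0; rewrite /clamp ge_max l0 ge_min lexx orbT. Qed.

Lemma clamp_id l x : 0 <= x <= l -> clamp l x = x.
Proof. by move=> /andP[x0 xl]; rewrite /clamp (min_idPl xl) (max_idPr x0). Qed.

Lemma clamp_lipschitz l x y : 0 <= l -> `|clamp l y - clamp l x| <= `|y - x|.
Proof.
move=> l0; wlog xy : x y / x <= y.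
  by move=> wl; have [/wl//|/ltW/wl] := leP x y; rewrite distrC (distrC x).
have yx : 0 <= y - x by rewrite subr_ge0.
rewrite (ger0_norm yx) /clamp.
have [?|?] := leP x l; have [?|?] := leP y l; have [?|?] := leP 0 x;
  have [?|?] := leP 0 y; have [?|?] := leP 0 l;
  rewrite ler_norml; apply/andP; split; lra.
Qed.

Lemma continuous_clamp l : continuous (clamp l).
Proof.
move=> x; apply: (@continuous_max _ _ (fun=> 0) (fun y => Num.min y l)).
  exact: cvg_cst.
apply: (@continuous_min _ _ (fun y => y) (fun=> l)).
  exact: cvg_id.
exact: cvg_cst.
Qed.

Lemma continuous_clampf f l : 0 <= l -> {within `[0, l], continuous f} ->
  continuous (fun y => f (clamp l y)).
Proof.
move=> l0 /subspace_continuousP cf x.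
have cx : `[0, l]%classic (clamp l x).
  by rewrite /= in_itv/= clamp_ge0 clamp_le.
apply: (@cvg_comp _ _ _ (clamp l) f _ (within `[0, l]%classic
  (nbhs (clamp l x))) _ _ (cf _ cx)) => P nP.
have : nbhs x [set y | `[0, l]%classic (clamp l y) -> P (clamp l y)].
  exact: (@continuous_clamp l x _ nP).
by apply: filterS => y; apply; rewrite /= in_itv/= clamp_ge0 clamp_le.
Qed.

(** Two functions, continuous on [0, l], with the same derivative inside and the
    same value at 0, agree. *)
Lemma eq_of_derive_oo f g df l : 0 <= l ->
  {within `[0, l], continuous f} -> {within `[0, l], continuous g} ->
  (forall y, 0 < y < l -> is_derive y 1 f (df y)) ->
  (forall y, 0 < y < l -> is_derive y 1 g (df y)) ->
  f 0 = g 0 -> forall y, 0 <= y <= l -> f y = g y.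
Proof.
move=> l0 cf cg dfE dgE fg0 y /andP[y0 yl].
have [|||z _ /=] := @MVT_segment R (fun t => f t - g t) (fun=> 0) 0 y.
- exact: y0.
- move=> t; rewrite in_itv/= => /andP[t0 ty].
  have tl : 0 < t < l by rewrite t0 (lt_le_trans ty).
  have := is_derive_addf (dfE _ tl) (is_derive_oppf (dgE _ tl)).
  by rewrite subrr.
- apply: (@continuous_subspaceW _ _ _ `[0, l]).
    by move=> t /=; rewrite !in_itv/= => /andP[-> /le_trans->].
  by move=> t; apply: continuousB; [exact: cf|exact: cg].
by rewrite fg0 mul0r; lra.
Qed.

Lemma antiderivative_right f a : continuous f ->
  exists2 G, G 0 = 0 & forall x, a < x -> is_derive x 1 G (f x).
Proof.
move=> cf.
pose F x := (\int[@lebesgue_measure R]_(t in [set` `[a, x]]) f t).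
exists (fun x => F x - F 0); first by rewrite subrr.
move=> x ax.
have xx1 : x < x + 1 by rewrite ltrDl.
have [|||dF F'] := @continuous_FTC1_closed R f a x (x + 1) xx1.
- apply: continuous_compact_integrable; first exact: segment_compact.
  exact: continuous_subspaceT.
- exact: ax.
- exact: cf.
apply: is_derive_subc.
split; first exact: dF.
by rewrite -derive1E; exact: F'.
Qed.

(** The integrals of [f] from different base points, normalised at 0, agree
    where they are both defined, so they patch together. *)
Lemma antiderivative_exists f : continuous f ->
  exists2 F, F 0 = 0 & forall x, is_derive x 1 F (f x).
Proof.
move=> cf.
have /choice[G GP] : forall a, exists G, G 0 = 0 /\
    forall x, a < x -> is_derive x 1 G (f x).
  by move=> a; have [G ? ?] := antiderivative_right a cf; exists G.
have GE a b x : a < 0 -> b < 0 -> a < x -> b < x -> G a x = G b x.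
  move=> a0 b0 ax bx.
  have [Ga0 Ga] := GP a; have [Gb0 Gb] := GP b.
  pose D y := G a y - G b y.
  have dD y : a < y -> b < y -> is_derive y 1 D 0.
    move=> ay bY; rewrite -(subrr (f y)).
    by apply: is_derive_addf; [exact: Ga|apply: is_derive_oppf; exact: Gb].
  suff : D x = D 0 by rewrite /D Ga0 Gb0; lra.
  have [x0|x0] := leP 0 x.
    have [| |z _ /=] := @MVT_segment R D (fun=> 0) 0 x x0.
    - by move=> y; rewrite in_itv/= => /andP[y0 yx]; apply: dD; lra.
    - apply: derivable_within_continuous => y.
      rewrite in_itv/= => /andP[y0 yx]; have [] := @dD y; [lra|lra|by []].
    by rewrite mul0r; lra.
  have [| |z _ /=] := @MVT_segment R D (fun=> 0) x 0 (ltW x0).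
  - by move=> y; rewrite in_itv/= => /andP[y0 yx]; apply: dD; lra.
  - apply: derivable_within_continuous => y.
    rewrite in_itv/= => /andP[y0 yx]; have [] := @dD y; [lra|lra|by []].
  by rewrite mul0r; lra.
exists (fun x => G (- (`|x| + 1)) x).
  by have [-> _] := GP (- (`|0 : R| + 1)).
move=> x.
have [_ Gx] := GP (- (`|x| + 2)).
have xle := ler_norm x; have xge := ler_norm (- x).
rewrite normrN in xge.
apply: (@near_eq_is_derive _ _ _ (G (- (`|x| + 2)))); last by apply: Gx; lra.
have : nbhs x (ball x 1) by exact: nbhsx_ballx.
apply: filterS => y xy; have {xy} : `|x - y| < 1 by exact: xy.
have yge := ler_norm (- y); rewrite normrN in yge.
rewrite ltr_norml => /andP[xy1 xy2].
have := normr_ge0 x; have := normr_ge0 y => ? ?.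
by apply: GE; lra.
Qed.

(** The antiderivative that vanishes at 0, so that [primitive f l] is the
    integral of [f] over [0, l].  It is meaningful when [f] is continuous on the line,
    and is the zero function when [f] has no antiderivative. *)
Definition primitive f : R -> R :=
  xget (fun=> 0) [set F | F 0 = 0 /\ forall x, is_derive x 1 F (f x)].

Lemma primitiveP f : continuous f ->
  primitive f 0 = 0 /\ forall x, is_derive x 1 (primitive f) (f x).
Proof.
move=> cf; rewrite /primitive; case: xgetP => // H.
have [F F0 dF] := antiderivative_exists cf.
by case: (H F).
Qed.

Lemma primitive0 f : continuous f -> primitive f 0 = 0.
Proof. by move=> /primitiveP[]. Qed.

Lemma is_derive_primitive f x : continuous f ->
  is_derive x 1 (primitive f) (f x).
Proof. by move=> /primitiveP[]. Qed.

Lemma continuous_primitive f : continuous f -> continuous (primitive f).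
Proof. by move=> cf x; exact/is_derive_continuous/is_derive_primitive. Qed.

Lemma primitiveE f F l : 0 <= l -> continuous f ->
  {within `[0, l], continuous F} ->
  (forall y, 0 < y < l -> is_derive y 1 F (f y)) ->
  primitive f l = F l - F 0.
Proof.
move=> l0 cf cF dF.
apply: (@eq_of_derive_oo (primitive f) (fun y => F y - F 0) f l) => //;
  last by rewrite lexx l0.
- exact/continuous_subspaceT/continuous_primitive.
- by move=> t; apply: continuousB; [exact: cF|exact: cvg_cst].
- by move=> y _; exact: is_derive_primitive.
- by move=> y /dF; exact: is_derive_subc.
- by rewrite primitive0// subrr.
Qed.

Lemma primitive_derive f F l : 0 <= l -> continuous f ->
  (forall y, is_derive y 1 F (f y)) -> primitive f l = F l - F 0.
Proof.
move=> l0 cf dF; apply: primitiveE => //.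
by apply: continuous_subspaceT => y; exact: is_derive_continuous.
Qed.

Lemma primitive_unique f F l : F 0 = 0 -> 0 <= l -> continuous f ->
  (forall y, is_derive y 1 F (f y)) -> primitive f l = F l.
Proof. by move=> F0 *; rewrite -[RHS]subr0 -F0; exact: primitive_derive. Qed.

Lemma primitiveD f g l : 0 <= l -> continuous f -> continuous g ->
  primitive (fun y => f y + g y) l = primitive f l + primitive g l.
Proof.
move=> l0 cf cg.
apply: (@primitive_unique _ (fun y => primitive f y + primitive g y)) => //.
- by rewrite !primitive0// addr0.
- exact: continuous_addf.
- by move=> y; apply: is_derive_addf; exact: is_derive_primitive.
Qed.

Lemma primitiveZ f c l : 0 <= l -> continuous f ->
  primitive (fun y => c * f y) l = c * primitive f l.
Proof.
move=> l0 cf.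
apply: (@primitive_unique _ (fun y => c * primitive f y)) => //.
- by rewrite primitive0// mulr0.
- exact: continuous_scalef.
- by move=> y; apply: is_derive_scalef; exact: is_derive_primitive.
Qed.

Lemma primitiveN f l : 0 <= l -> continuous f ->
  primitive (fun y => - f y) l = - primitive f l.
Proof.
move=> l0 cf; rewrite -mulN1r -primitiveZ//; congr (primitive _ l).
by apply/funext => y; rewrite mulN1r.
Qed.

Lemma primitive_ge0_itv f a b : continuous f -> 0 <= a -> a <= b ->
  (forall y, a < y < b -> 0 <= f y) -> primitive f a <= primitive f b.
Proof.
move=> cf a0 ab f0.
have [ab'|ab'] := ltP a b; last first.
  by rewrite (_ : a = b)//; apply/eqP; rewrite eq_le ab ab'.
have [||z zab] := @MVT R (primitive f) f a b ab'.
- by move=> y _; exact: is_derive_primitive.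
- exact/continuous_subspaceT/continuous_primitive.
move: zab; rewrite in_itv/= => /f0 fz E; rewrite -subr_ge0 E mulr_ge0//.
by rewrite subr_ge0.
Qed.

Lemma primitive_ge0 f l : 0 <= l -> continuous f ->
  (forall y, 0 < y < l -> 0 <= f y) -> 0 <= primitive f l.
Proof.
by move=> l0 cf f0; rewrite -(primitive0 cf); exact: primitive_ge0_itv.
Qed.

Lemma le_primitive f g l : 0 <= l -> continuous f -> continuous g ->
  (forall y, 0 < y < l -> f y <= g y) -> primitive f l <= primitive g l.
Proof.
move=> l0 cf cg fg; rewrite -subr_ge0 -primitiveN// -primitiveD//; last first.
  exact: continuous_oppf.
apply: primitive_ge0 => //.
  by apply: continuous_addf => //; exact: continuous_oppf.
by move=> y /fg; rewrite subr_ge0.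
Qed.

Lemma eq_primitive f g l : 0 <= l -> continuous f -> continuous g ->
  (forall y, 0 < y < l -> f y = g y) -> primitive f l = primitive g l.
Proof.
move=> l0 cf cg fg; apply/eqP.
by rewrite eq_le !le_primitive// => y /fg ->.
Qed.

Lemma primitive_cst c l : 0 <= l -> primitive (fun=> c) l = c * l.
Proof.
move=> l0; apply: (@primitive_unique _ (fun y => c * y)) => //.
- by rewrite mulr0.
- by move=> x; exact: cvg_cst.
- by move=> y; rewrite -[X in is_derive _ _ _ X]mulr1; exact: is_derive_scalef.
Qed.

Lemma norm_primitive_le f c l : 0 <= l -> continuous f ->
  (forall y, 0 < y < l -> `|f y| <= c) -> `|primitive f l| <= c * l.
Proof.
move=> l0 cf fc; rewrite ler_norml -mulNr.
rewrite -(primitive_cst c l0) -(primitive_cst (- c) l0).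
have cc k : continuous (fun _ : R => k : R) by move=> x; exact: cvg_cst.
by apply/andP; split; apply: le_primitive => // y /fc;
  rewrite ler_norml => /andP[].
Qed.

Lemma primitive_eq0 f l : continuous f ->
  (forall y, 0 < y < l -> 0 <= f y) -> primitive f l = 0 ->
  forall y, 0 < y < l -> f y = 0.
Proof.
move=> cf f0 I0 y /[dup] y0l /andP[y0 yl].
have P0 z : 0 < z < l -> primitive f z = 0.
  move=> /andP[z0 zl]; apply/eqP; rewrite eq_le -{1}I0; apply/andP; split.
    apply: primitive_ge0_itv => //; try lra; move=> t tz; apply: f0; lra.
  apply: primitive_ge0 => //; try lra; move=> t tz; apply: f0; lra.
have [_ <-] := is_derive_primitive y cf.
have : is_derive y 1 (primitive f) 0.
  apply: (@near_eq_is_derive _ _ _ (fun=> 0)).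
  have : \forall z \near y, z \in `]0, l[.
    by apply: near_in_itvoo; rewrite in_itv.
  by apply: filterS => z; rewrite in_itv/= => /P0.
by case.
Qed.

End Calculus.

(** * Limits of integrals, and bump functions *)

Section Convergence.
Variable R : realType.
Implicit Types (f g : R -> R) (x y l e : R).

(** Joint (that is, continuous) convergence of functions at each point of a
    segment implies convergence of the integrals, along any filter. *)
Lemma primitive_cvg (T : Type) (F : set_system T) (FF : Filter F)
    (u : T -> R -> R) f l : 0 < l ->
  (forall n, continuous (u n)) -> continuous f ->
  (forall x, 0 <= x <= l ->
    u p.2 p.1 @[p --> filter_prod (nbhs x) F] --> f x) ->
  primitive (u n) l @[n --> F] --> primitive f l.
Proof.
move=> l0 cu cf uf; apply/cvgrPdist_le => e e0.
have el0 : 0 < e / l / 2 by rewrite !divr_gt0.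
have unif : \forall n \near F, `[0, l]%classic `<=`
    (fun n x => `|f x - u n x| <= e / l) n.
  apply: (iffLR (compact_near_coveringP _) (@segment_compact _ 0 l)).
  move=> x /=; rewrite in_itv/= => x0l.
  have := uf _ x0l; move/cvgrPdist_lt => /(_ _ el0) h1.
  have /cvgrPdist_lt/(_ _ el0) h2 : f t @[t --> x] --> f x by exact: cf.
  have h3 : \forall p \near filter_prod (nbhs x) F, `|f x - f p.1| < e / l / 2.
    exact: (@cvg_fst _ _ (nbhs x) F FF _ h2).
  apply: filterS (filterI h1 h3) => -[y n] /= [].
  move=> d1 d2.
  rewrite (_ : f y - u n y = (f x - u n y) - (f x - f y)); last by ring.
  apply: le_trans (ler_normB _ _) _.
  by rewrite [leRHS](splitr (e / l)) lerD// ltW.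
near=> n.
have dn : continuous (fun y => f y + - u n y).
  by apply: continuous_addf => //; exact: continuous_oppf.
have l0' := ltW l0.
rewrite -(primitiveN l0' (cu n)) -primitiveD//; last exact: continuous_oppf.
rewrite -[leRHS](divfK (lt0r_neq0 l0)).
apply: norm_primitive_le => //.
move=> y /andP[y0 yl]; have : `[0, l]%classic `<=`
    (fun n x => `|f x - u n x| <= e / l) n by near: n.
by apply => /=; rewrite in_itv/= !ltW.
Unshelve. all: by end_near. Qed.

(** Bounded families of reals converge along ultrafilters, which makes the
    extraction of subsequences unnecessary. *)
Lemma ultra_bounded_cvg (T : Type) (F : set_system T) (FU : UltraFilter F)
    (a : T -> R) (C : R) : (forall n, `|a n| <= C) -> cvg (a n @[n --> F]).
Proof.
move=> aC.
have GF : ProperFilter (a n @[n --> F]) by exact: fmap_proper_filter.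
have [G [GU FG]] := ultraFilterLemma GF.
have GK : G `[- C, C]%classic.
  by apply: FG; apply: nearW => n /=; rewrite in_itv/= -ler_norml.
have := @segment_compact R (- C) C; rewrite compact_ultra.
move=> /(_ G GU GK)[L [_ GL]].
apply/cvg_ex; exists L.
suff <- : G = (a n @[n --> F]) by [].
apply/predeqP => A; split; last exact: FG.
move=> GA; have [//|FnA] := in_ultra_setVsetC (a @^-1` A) FU.
have /FG GnA : (a n @[n --> F]) (~` A) by exact: FnA.
have G0 : G set0 by rewrite -(setICr A); exact: filterI.
by have [] := filter_ex G0.
Qed.

Lemma derive_ge0_le f g x y : (forall z : R, is_derive z 1 f (g z)) ->
  (forall z, x <= z <= y -> 0 <= g z) -> x <= y -> f x <= f y.
Proof.
move=> df g0 xy; have [|z zxy] := MVT_segment xy (fun z _ => df z).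
  by apply: continuous_subspaceT => z; exact: is_derive_continuous.
rewrite in_itv/= in zxy => E; rewrite -subr_ge0 E mulr_ge0 ?subr_ge0//.
exact: g0.
Qed.

Lemma expR_le_quad x : `|x| <= 1 / 2 -> expR x <= 1 + x + 2 * x ^+ 2.
Proof.
rewrite ler_norml => /andP[x1 x2].
have := expR_ge1Dx (- x) => ex.
have e1 : expR x * expR (- x) = 1 by rewrite -expRD subrr expR0.
have ep := expR_gt0 x.
have x2p : 0 <= x ^+ 2 by rewrite sqr_ge0.
have x1p : 0 < 1 - x by lra.
rewrite -(ler_pM2r x1p).
have : expR x * (1 - x) <= expR x * expR (- x) by rewrite ler_pM2l.
rewrite e1.
have : 0 <= x ^+ 2 * (1 - 2 * x) by apply: mulr_ge0 => //; lra.
have -> : (1 + x + 2 * x ^+ 2) * (1 - x) = 1 + x ^+ 2 * (1 - 2 * x) by ring.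
lra.
Qed.

Lemma is_derive_compf f g x a b : is_derive (g x) 1 f a ->
  is_derive x 1 g b -> is_derive x 1 (fun y => f (g y)) (a * b).
Proof. exact: is_derive1_comp. Qed.

(** The function max(0, z)^3 / 6 is of class C^2. *)
Lemma cubic_ramp_exists : exists f f1 f2 : R -> R,
  [/\ forall z : R, is_derive z 1 f (f1 z),
      forall z : R, is_derive z 1 f1 (f2 z),
      continuous f2, forall z, 0 < z -> 0 < f z & forall z, z <= 0 -> f z = 0].
Proof.
pose m (z : R) : R := Num.max 0 z.
have cm : continuous m.
  by move=> z; apply: continuous_max; [exact: cvg_cst|exact: cvg_id].
have c1 := continuous_primitive cm.
have mN z : z <= 0 -> m z = 0 by move=> z0; rewrite /m; apply/max_idPl.
have mP z : 0 <= z -> m z = z by move=> z0; rewrite /m; apply/max_idPr.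
have dm z := is_derive_primitive z cm.
have d1 z := is_derive_primitive z c1.
(* both primitives vanish on the negative half-line *)
have vanish g (cg : continuous g) : (forall z, z <= 0 -> g z = 0) ->
    forall z, z <= 0 -> primitive g z = 0.
  move=> g0 z z0; apply/eqP; rewrite eq_le -(primitive0 cg).
  apply/andP; split; last first.
    rewrite -lerN2; apply: (@derive_ge0_le (fun t => - primitive g t) (fun t => - g t)) => //.
      by move=> t; apply: is_derive_oppf; exact: is_derive_primitive.
    by move=> t /andP[_ t0]; rewrite g0// oppr0.
  apply: (@derive_ge0_le _ g) => //.
    by move=> t; exact: is_derive_primitive.
  by move=> t /andP[_ t0]; rewrite g0.
have dsq (t : R) : is_derive t 1 (fun t => t ^+ 2 / 2) t.
  by apply: is_derive_eq; rewrite /GRing.scale/=; field.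
have dcu (t : R) : is_derive t 1 (fun t => t ^+ 3 / 6) (t ^+ 2 / 2).
  by apply: is_derive_eq; rewrite /GRing.scale/=; field.
have csq : continuous (fun t : R => t ^+ 2 / 2).
  by move=> t; exact: is_derive_continuous (dsq t).
have p1 z : 0 <= z -> primitive m z = z ^+ 2 / 2.
  move=> z0; transitivity (primitive (fun t => t) z).
    apply: eq_primitive => //; first by move=> t; exact: cvg_id.
    by move=> t /andP[t0 _]; rewrite mP// ltW.
  apply: (@primitive_unique _ _ (fun t => t ^+ 2 / 2)) => //.
  - by rewrite expr0n/= mul0r.
  - by move=> t; exact: cvg_id.
have p2 z : 0 <= z -> primitive (primitive m) z = z ^+ 3 / 6.
  move=> z0; transitivity (primitive (fun t => t ^+ 2 / 2) z).
    by apply: eq_primitive => // t /andP[t0 _]; rewrite p1// ltW.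
  apply: (@primitive_unique _ _ (fun t => t ^+ 3 / 6)) => //.
  by rewrite expr0n/= mul0r.
exists (primitive (primitive m)), (primitive m), m; split => // z z0.
  by rewrite p2 ?ltW// divr_gt0// exprn_gt0.
exact: (vanish _ c1 (vanish _ cm mN)).
Qed.

(** A C^2 function that is positive on ]x, y[ and zero elsewhere. *)
Lemma bump_exists x y : x < y -> exists f f1 f2 : R -> R,
  [/\ forall z : R, is_derive z 1 f (f1 z),
      forall z : R, is_derive z 1 f1 (f2 z),
      continuous f2, forall z, x < z < y -> 0 < f z &
      forall z, ~~ (x < z < y) -> f z = 0].
Proof.
move=> xy; have [r [r1 [r2 [dr dr1 cr2 rp rn]]]] := cubic_ramp_exists.
pose q z := (z - x) * (y - z).
have dq (z : R) : is_derive z 1 q (x + y - 2 * z).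
  apply: is_derive_eq; rewrite /GRing.scale/=; ring.
have dq1 (z : R) : is_derive z 1 (fun z => x + y - 2 * z) (- 2).
  apply: is_derive_eq; rewrite /GRing.scale/=; ring.
have cq1 : continuous (fun z : R => x + y - 2 * z).
  by move=> z; exact: is_derive_continuous (dq1 z).
exists (fun z => r (q z)), (fun z => r1 (q z) * (x + y - 2 * z)),
  (fun z => r2 (q z) * (x + y - 2 * z) * (x + y - 2 * z) + r1 (q z) * (- 2)).
split.
- by move=> z; exact: is_derive_compf.
- by move=> z; apply: is_derive_mulf.
- have cq : continuous q by move=> z; exact: is_derive_continuous (dq z).
  have cr1 : continuous r1 by move=> z; exact: is_derive_continuous (dr1 z).
  apply: continuous_addf; apply: continuous_mulf.
  + apply: continuous_mulf => // z.
    by apply: continuous_comp; [exact: cq|exact: cr2].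
  + exact: cq1.
  + by move=> z; apply: continuous_comp; [exact: cq|exact: cr1].
  + by move=> z; exact: cvg_cst.
- by move=> z /andP[xz zy]; apply/rp/mulr_gt0; rewrite subr_gt0.
- move=> z; rewrite negb_and -!leNgt => /orP[zx|yz]; apply/rn.
    by apply: mulr_le0_ge0; lra.
  by apply: mulr_ge0_le0; lra.
Qed.

End Convergence.

(** * Functions on a metric graph *)

Section MetricGraph.
Variables (R : realType) (E : finType) (V : Type).
Variables (src tgt : E -> V) (l : E -> R).
Hypothesis l_gt0 : forall j, 0 < l j.

Let l_ge0 j : 0 <= l j. Proof. exact/ltW. Qed.

(** The functions on the graph that are of class C^2 on each (closed) edge and
    single-valued at the vertices, bundled with their derivatives along the
    edges.  The edge functions are defined on the whole real line, but only
    their values on [0, l j] matter. *)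
Record c2fun := C2fun {
  val0 : E -> R -> R;
  val1 : E -> R -> R;
  val2 : E -> R -> R;
  valV : V -> R;
  derive_val0 : forall (j : E) (y : R), is_derive y 1 (val0 j) (val1 j y);
  derive_val1 : forall (j : E) (y : R), is_derive y 1 (val1 j) (val2 j y);
  continuous_val2 : forall j, continuous (val2 j);
  val_src : forall j, val0 j 0 = valV (src j);
  val_tgt : forall j, val0 j (l j) = valV (tgt j)
}.

Implicit Types (f u phi : c2fun) (j : E) (y : R).

Lemma continuous_val0 f j : continuous (val0 f j).
Proof. by move=> y; exact/is_derive_continuous/derive_val0. Qed.

Lemma continuous_val1 f j : continuous (val1 f j).
Proof. by move=> y; exact/is_derive_continuous/derive_val1. Qed.

Hint Resolve continuous_val0 continuous_val1 continuous_val2 : core.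

(** Kirchhoff's law for the edge derivatives [d], in weak form.  The derivative
    pointing into the edge [j] is [d j 0] at its source and [- d j (l j)] at
    its target, so the test function [a] that is 1 at one vertex and 0 at the
    others gives the law at that vertex. *)
Definition kirchhoff (d : E -> R -> R) : Prop := forall a : V -> R,
  \sum_j (d j (l j) * a (tgt j) - d j 0 * a (src j)) = 0.

(** The integral over the graph of a function given on each edge. *)
Definition graph_integral (f : E -> R -> R) : R := \sum_j primitive (f j) (l j).

Section Integral.
Implicit Types g : E -> R -> R.

Lemma graph_integralD g g' : (forall j, continuous (g j)) ->
  (forall j, continuous (g' j)) ->
  graph_integral (fun j y => g j y + g' j y) =
  graph_integral g + graph_integral g'.
Proof.
by move=> cg cg'; rewrite -big_split; apply: eq_bigr => j _; exact: primitiveD.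
Qed.

Lemma graph_integralZ (c : R) g : (forall j, continuous (g j)) ->
  graph_integral (fun j y => c * g j y) = c * graph_integral g.
Proof.
by move=> cg; rewrite mulr_sumr; apply: eq_bigr => j _; exact: primitiveZ.
Qed.

Lemma graph_integralN g : (forall j, continuous (g j)) ->
  graph_integral (fun j y => - g j y) = - graph_integral g.
Proof.
by move=> cg; rewrite -sumrN; apply: eq_bigr => j _; exact: primitiveN.
Qed.

Lemma graph_integral_ge0 g : (forall j, continuous (g j)) ->
  (forall j y, 0 < y < l j -> 0 <= g j y) -> 0 <= graph_integral g.
Proof.
move=> cg g0; apply: sumr_ge0 => j _.
by apply: primitive_ge0 => // y; exact: g0.
Qed.

Lemma le_graph_integral g g' : (forall j, continuous (g j)) ->
  (forall j, continuous (g' j)) ->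
  (forall j y, 0 < y < l j -> g j y <= g' j y) ->
  graph_integral g <= graph_integral g'.
Proof.
move=> cg cg' gg; apply: ler_sum => j _.
by apply: le_primitive => // y; exact: gg.
Qed.

Lemma eq_graph_integral g g' : (forall j, continuous (g j)) ->
  (forall j, continuous (g' j)) ->
  (forall j y, 0 < y < l j -> g j y = g' j y) ->
  graph_integral g = graph_integral g'.
Proof.
move=> cg cg' gg; apply: eq_bigr => j _.
by apply: eq_primitive => // y; exact: gg.
Qed.

Lemma graph_integral0 g : (forall j y, g j y = 0) -> graph_integral g = 0.
Proof.
move=> g0; have -> : g = fun _ _ => 0.
  by apply/funext => j; apply/funext => y; exact: g0.
by apply: big1 => j _; rewrite primitive_cst ?mul0r.
Qed.

Lemma graph_integral_eq0 g : (forall j, continuous (g j)) ->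
  (forall j y, 0 < y < l j -> 0 <= g j y) -> graph_integral g = 0 ->
  forall j y, 0 < y < l j -> g j y = 0.
Proof.
move=> cg g0 I0 j; apply: primitive_eq0 => //; first exact: g0.
apply: (psumr_eq0P _ I0) => // k _.
by apply: primitive_ge0 => // y; exact: g0.
Qed.

End Integral.

(** * The conditions are necessary *)

Section Necessity.
Variables (H : E -> R -> R) (u : c2fun).
Hypothesis cH : forall j, continuous (H j).
Hypothesis equ : forall j y, 0 < y < l j ->
  val2 u j y = - (H j y * expR (val0 u j y)).
Hypothesis ku : kirchhoff (val1 u).
Hypothesis H_neq0 : exists j y, 0 < y < l j /\ H j y != 0.

Let cHe j : continuous (fun y => H j y * expR (val0 u j y)).
Proof. by apply: continuous_mulf => //; exact: continuous_expf. Qed.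

(** By the fundamental theorem of calculus, this is Kirchhoff's law tested with
    the constant 1. *)
Lemma graph_integral_rhs_eq0 :
  graph_integral (fun j y => H j y * expR (val0 u j y)) = 0.
Proof.
transitivity (- \sum_j (val1 u j (l j) * 1 - val1 u j 0 * 1)); last first.
  by rewrite (ku (fun=> 1)) oppr0.
rewrite -sumrN; apply: eq_bigr => j _; rewrite !mulr1 opprB.
rewrite (_ : _ - _ = - val1 u j (l j) - - val1 u j 0); last by ring.
apply: (@primitiveE _ _ (fun y => - val1 u j y)) => //.
  by apply: continuous_subspaceT; exact: continuous_oppf.
move=> y /equ E2; rewrite -[X in is_derive _ _ _ X]opprK -E2.
exact/is_derive_oppf/derive_val1.
Qed.

Lemma rhs_pos : exists j y, 0 < y < l j /\ 0 < H j y.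
Proof.
apply: contrapT => npos; have [j [y [y0l /eqP]]] := H_neq0; apply.
have Hle j' y' : 0 < y' < l j' -> H j' y' <= 0.
  by move=> y'0l; rewrite leNgt; apply/negP => Hp; apply: npos; exists j', y'.
suff /eqP : - (H j y * expR (val0 u j y)) = 0.
  rewrite oppr_eq0 mulf_eq0 [X in _ || X]gt_eqF ?expR_gt0// orbF.
  by move/eqP.
apply: (@graph_integral_eq0 (fun j y => - (H j y * expR (val0 u j y)))) => //.
- by move=> k; exact: continuous_oppf.
- move=> k z /Hle; rewrite -mulNr -oppr_ge0 => h0.
  by rewrite mulr_ge0// expR_ge0.
- by rewrite graph_integralN// graph_integral_rhs_eq0 oppr0.
Qed.

Lemma rhs_neg : exists j y, 0 < y < l j /\ H j y < 0.
Proof.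
apply: contrapT => npos; have [j [y [y0l /eqP]]] := H_neq0; apply.
have Hge j' y' : 0 < y' < l j' -> 0 <= H j' y'.
  by move=> y'0l; rewrite leNgt; apply/negP => Hp; apply: npos; exists j', y'.
suff /eqP : H j y * expR (val0 u j y) = 0.
  by rewrite mulf_eq0 [X in _ || X]gt_eqF ?expR_gt0// orbF => /eqP.
apply: (@graph_integral_eq0 (fun j y => H j y * expR (val0 u j y))) => //.
- by move=> k z /Hge h0; rewrite mulr_ge0// expR_ge0.
- exact: graph_integral_rhs_eq0.
Qed.

(** Multiplying the equation by exp(-u) and integrating by parts gives
    the integral of [H] as minus that of u'^2 exp(-u). *)
Lemma graph_integral_coef_lt0 : graph_integral H < 0.
Proof.
pose g j y := val1 u j y * expR (- val0 u j y).
pose q j y := val1 u j y * val1 u j y * expR (- val0 u j y).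
have ce j : continuous (fun y => expR (- val0 u j y)).
  by apply: continuous_expf; exact: continuous_oppf.
have cg j : continuous (g j) by exact: continuous_mulf.
have cq j : continuous (q j).
  by apply: continuous_mulf => //; exact: continuous_mulf.
have q0 j y : 0 < y < l j -> 0 <= q j y.
  by move=> _; rewrite mulr_ge0// ?expR_ge0// -expr2 sqr_ge0.
have IE : graph_integral H + graph_integral q = 0.
  rewrite -graph_integralD//.
  rewrite -[RHS]oppr0 -(ku (fun v => expR (- valV u v))) -sumrN.
  apply: eq_bigr => j _.
  transitivity (- g j (l j) - - g j 0); last by rewrite /g val_src val_tgt; ring.
  apply: (@primitiveE _ _ (fun y => - g j y)) => //.
  - exact: continuous_addf.
  - by apply: continuous_subspaceT; exact: continuous_oppf.
  move=> y /equ E2.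
  have dg := is_derive_mulf (derive_val1 u j y)
    (is_derive_expf (is_derive_oppf (derive_val0 u j y))).
  apply: is_derive_eq (is_derive_oppf dg) _.
  have ee : expR (val0 u j y) * expR (- val0 u j y) = 1.
    by rewrite -expRD subrr expR0.
  by rewrite E2 /q -[X in _ = X + _]mulr1 -ee; ring.
rewrite ltNge; apply/negP => H0.
have /(graph_integral_eq0 cq q0) qE : graph_integral q = 0.
  have := graph_integral_ge0 cq q0; lra.
have u10 j y : 0 < y < l j -> val1 u j y = 0.
  move=> /qE/eqP; rewrite mulf_eq0 [X in _ || X]gt_eqF ?expR_gt0// orbF.
  by rewrite mulf_eq0 orbb => /eqP.
have [j [y [y0l /eqP]]] := H_neq0; apply.
have u20 : val2 u j y = 0.
  have [_ <-] := derive_val1 u j y.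
  have : is_derive y 1 (val1 u j) 0.
    apply: (@near_eq_is_derive _ _ _ (fun=> 0)).
    have : \forall z \near y, z \in `]0, l j[.
      by apply: near_in_itvoo; rewrite in_itv.
    by apply: filterS => z; rewrite in_itv/= => /u10.
  by case.
have /eqP := equ y0l; rewrite u20 eq_sym oppr_eq0 mulf_eq0.
by rewrite [X in _ || X]gt_eqF ?expR_gt0// orbF => /eqP.
Qed.

End Necessity.

(** * Energy and Green's formula *)

Ltac solve_continuous := intros; repeat first
  [ solve [auto] | by move=> ?; exact: cvg_cst
  | apply: continuous_addf | apply: continuous_oppf
  | apply: continuous_expf | apply: continuous_mulf ].

Section Constructions.

(** The linear combination f + c g. *)
Definition c2comb (f : c2fun) (c : R) (g : c2fun) : c2fun.
Proof.
refine (@C2fun (fun j y => val0 f j y + c * val0 g j y)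
    (fun j y => val1 f j y + c * val1 g j y)
    (fun j y => val2 f j y + c * val2 g j y)
    (fun v => valV f v + c * valV g v) _ _ _ _ _).
- move=> j y; apply: is_derive_addf; first exact: derive_val0.
  by apply: is_derive_scalef; exact: derive_val0.
- move=> j y; apply: is_derive_addf; first exact: derive_val1.
  by apply: is_derive_scalef; exact: derive_val1.
- by solve_continuous.
- by move=> j; rewrite !val_src.
- by move=> j; rewrite !val_tgt.
Defined.

(** The constant functions. *)
Definition c2cst (c : R) : c2fun.
Proof.
refine (@C2fun (fun _ _ => c) (fun _ _ => 0) (fun _ _ => 0) (fun=> c) _ _ _ _ _).
- by solve_continuous.
- by [].
- by [].
Defined.

(** The solution of the Dirichlet problem: the second derivative [g] and the
    values [a] at the vertices are prescribed. *)
Section Dirichlet.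
Variables (g : E -> R -> R) (cg : forall j, continuous (g j)) (a : V -> R).

Let slope j : R :=
  (a (tgt j) - a (src j) - primitive (primitive (g j)) (l j)) / l j.

Definition dirichlet : c2fun.
Proof.
refine (@C2fun
    (fun j y => a (src j) + (slope j * y + primitive (primitive (g j)) y))
    (fun j y => slope j + primitive (g j) y) g a _ _ cg _ _).
- move=> j y; rewrite -[X in is_derive _ _ _ X]add0r.
  have d1 := is_derive_scalef (slope j) (is_derive_id y (1 : R)).
  have d2 : is_derive y 1 (primitive (primitive (g j))) (primitive (g j) y).
    by apply: is_derive_primitive; exact: continuous_primitive.
  rewrite mulr1 in d1.
  exact: (is_derive_addf (is_derive_cst (a (src j)) y 1) (is_derive_addf d1 d2)).
- move=> j y; rewrite -[X in is_derive _ _ _ X]add0r.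
  have d2 : is_derive y 1 (primitive (g j)) (g j y) by exact: is_derive_primitive.
  exact: (is_derive_addf (is_derive_cst (slope j) y 1) d2).
- move=> j; rewrite mulr0 primitive0 ?addr0//.
  exact: continuous_primitive.
- by move=> j; rewrite /slope divfK ?gt_eqF//; ring.
Defined.

End Dirichlet.

Lemma bump_on_edge j x y : 0 < x -> x < y -> y < l j ->
  exists phi : c2fun,
    (forall k z, (k == j) && (x < z < y) -> 0 < val0 phi k z) /\
    (forall k z, ~~ ((k == j) && (x < z < y)) -> val0 phi k z = 0).
Proof.
move=> x0 xy yl; have [f [f1 [f2 [df df1 cf2 fp f0]]]] := bump_exists xy.
pose on (g : R -> R) (k : E) (z : R) : R := if k == j then g z else 0.
have d0 k (z : R) : is_derive z 1 (on f k) (on f1 k z).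
  rewrite /on; case: eqP => _; [exact: df|exact: is_derive_cst].
have d1 k (z : R) : is_derive z 1 (on f1 k) (on f2 k z).
  rewrite /on; case: eqP => _; [exact: df1|exact: is_derive_cst].
have c2 k : continuous (on f2 k).
  by rewrite /on; case: eqP => _ //; solve_continuous.
have s0 k : on f k 0 = 0.
  by rewrite /on; case: eqP => // _; apply: f0; rewrite negb_and -!leNgt; lra.
have s1 k : on f k (l k) = 0.
  rewrite /on; case: eqP => // ->; apply: f0; rewrite negb_and -!leNgt; lra.
exists (@C2fun _ _ _ (fun=> 0) d0 d1 c2 s0 s1); split => k z /=; rewrite /on.
  by case: eqP => //= _; exact: fp.
by case: eqP => //= _; exact: f0.
Qed.

End Constructions.

(** The Dirichlet integral, without the customary factor 1/2. *)
Definition energy (u : c2fun) : R :=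
  graph_integral (fun j y => val1 u j y * val1 u j y).

Definition bilin (u phi : c2fun) : R :=
  graph_integral (fun j y => val1 u j y * val1 phi j y).

Lemma energy_ge0 u : 0 <= energy u.
Proof.
apply: graph_integral_ge0; first by solve_continuous.
by move=> j y _; rewrite -expr2 sqr_ge0.
Qed.

Lemma energy_comb u t phi :
  energy (c2comb u t phi) =
  energy u + (2 * t * bilin u phi + t ^+ 2 * energy phi).
Proof.
rewrite /energy /bilin -!graph_integralZ -?graph_integralD; try by solve_continuous.
by congr graph_integral; apply/funext => j; apply/funext => y /=; ring.
Qed.

(** The boundary term of an integration by parts. *)
Definition bdry (w : E -> R -> R) (d : E -> R -> R) : R :=
  \sum_j (w j (l j) * d j (l j) - w j 0 * d j 0).

(** Green's formula. *)
Lemma green_formula (w phi : c2fun) : bilin w phi =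
  bdry (val0 w) (val1 phi) -
  graph_integral (fun j y => val0 w j y * val2 phi j y).
Proof.
apply/eqP; rewrite eq_sym subr_eq -graph_integralD; try by solve_continuous.
apply/eqP/esym/eq_bigr => j _.
apply: (@primitive_derive _ _ (fun y => val0 w j y * val1 phi j y)) => //.
  by solve_continuous.
by move=> y; apply: is_derive_mulf; [exact: derive_val0|exact: derive_val1].
Qed.

(** * Compactness of sequences of bounded energy *)

Lemma graph_integral_cvg (T : Type) (F : set_system T) (FF : Filter F)
    (g : T -> E -> R -> R) (g' : E -> R -> R) :
  (forall n j, continuous (g n j)) -> (forall j, continuous (g' j)) ->
  (forall j x, 0 <= x <= l j ->
    g p.2 j p.1 @[p --> filter_prod (nbhs x) F] --> g' j x) ->
  graph_integral (g n) @[n --> F] --> graph_integral g'.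
Proof.
move=> cg cg' gg'; apply: cvg_big; first exact: add_continuous.
move=> j _; apply: (@primitive_cvg _ _ F FF (fun n => g n j)) => //.
by move=> x; exact: gg'.
Qed.

(** A modulus of continuity that depends only on the energy.  It comes from
    2 |p| <= e p^2 + 1/e, integrated along the edge. *)
Lemma energy_modulus (u : c2fun) (M e x y : R) j : energy u <= M -> 0 < e ->
  0 <= x -> x <= y -> y <= l j ->
  `|val0 u j y - val0 u j x| <= (e * M + (y - x) / e) / 2.
Proof.
move=> uM e0 x0 xy yl.
pose p2 y := val1 u j y * val1 u j y.
have cp2 : continuous p2 by exact: continuous_mulf.
have p20 z : 0 <= p2 z by rewrite /p2 -expr2 sqr_ge0.
have PM : primitive p2 y - primitive p2 x <= M.
  have Px : 0 <= primitive p2 x by exact: primitive_ge0.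
  have Py : primitive p2 y <= primitive p2 (l j).
    by apply: primitive_ge0_itv => //; exact: le_trans xy.
  have Pl : primitive p2 (l j) <= energy u.
    rewrite /energy /graph_integral (bigD1 j)//= lerDl; apply: sumr_ge0 => k _.
    apply: primitive_ge0 => //; first by solve_continuous.
    by move=> z _; rewrite -expr2 sqr_ge0.
  lra.
have bound s : s * s = 1 ->
    s * (val0 u j y - val0 u j x) <= (e * M + (y - x) / e) / 2.
  move=> ss.
  pose D z := e / 2 * primitive p2 z + ((2 * e)^-1 * z + - (s * val0 u j z)).
  pose D1 z := e / 2 * p2 z + ((2 * e)^-1 * 1 + - (s * val1 u j z)).
  have dD (z : R) : is_derive z 1 D (D1 z).
    have dP : is_derive z 1 (primitive p2) (p2 z) by exact: is_derive_primitive.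
    exact: (is_derive_addf (is_derive_scalef _ dP)
      (is_derive_addf (is_derive_scalef _ (is_derive_id z (1 : R)))
        (is_derive_oppf (is_derive_scalef s (derive_val0 u j z))))).
  have D10 z : 0 <= D1 z.
    have -> : D1 z = (e * val1 u j z - s) ^+ 2 / (2 * e) + (1 - s * s) / (2 * e).
      by rewrite /D1 /p2; field; rewrite gt_eqF.
    by rewrite ss subrr mul0r addr0 divr_ge0 ?sqr_ge0// mulr_ge0// ltW.
  have Dxy : D x <= D y by exact: (derive_ge0_le dD).
  have eM : e / 2 * (primitive p2 y - primitive p2 x) <= e / 2 * M.
    by rewrite ler_pM2l// divr_gt0.
  have -> : (e * M + (y - x) / e) / 2 = e / 2 * M + (2 * e)^-1 * (y - x).
    by field; rewrite gt_eqF.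
  by move: Dxy eM; rewrite /D; lra.
rewrite ler_norml; apply/andP; split.
  by rewrite lerNl -mulN1r; apply: bound; rewrite mulrNN mulr1.
by rewrite -[leLHS]mul1r; apply: bound; rewrite mulr1.
Qed.

(** The graph is connected: a property of vertices that is propagated along the
    edges in both directions, and that holds at the source of one edge, holds at
    the source of every edge. *)
Hypothesis conn : forall S : V -> Prop, (forall j, S (src j) <-> S (tgt j)) ->
  forall j k, S (src j) -> S (src k).

(** Compactness: a sequence of functions of bounded energy, vanishing at a given
    vertex, converges uniformly along an ultrafilter.  Convergence is stated
    as joint convergence at each point of a closed edge, which is what
    integrals need; since the functions are only controlled on the edge, the
    argument is first projected to it. *)
Lemma energy_compactness (u : nat -> c2fun) (M : R) (j0 : E) :
  (forall n, energy (u n) <= M) -> (forall n, valV (u n) (src j0) = 0) ->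
  exists (F : set_system nat) (w : E -> R -> R) (wV : V -> R),
  [/\ UltraFilter F, \oo `<=` F, forall j, continuous (w j),
    forall j, w j 0 = wV (src j) /\ w j (l j) = wV (tgt j) &
    forall j x, 0 <= x <= l j ->
      val0 (u p.2) j (clamp (l j) p.1)
        @[p --> filter_prod (nbhs x) F] --> w j x].
Proof.
move=> uM un0.
pose cl j := clamp (l j).
have cl0 j x : 0 <= cl j x by exact: clamp_ge0.
have cll j x : cl j x <= l j by exact: clamp_le.
have clid j x : 0 <= x -> x <= l j -> cl j x = x.
  by move=> x0 xl; apply: clamp_id; rewrite x0.
have cl_lip j x y : `|cl j y - cl j x| <= `|y - x| by exact: clamp_lipschitz.
have M0 : 0 <= M by apply: le_trans (uM 0%N); exact: energy_ge0.
have mod n j x y e : 0 < e ->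
    `|val0 (u n) j (cl j y) - val0 (u n) j (cl j x)|
      <= (e * M + `|y - x| / e) / 2.
  move=> e0; wlog xy : x y / cl j x <= cl j y.
    move=> wl; have [|/ltW] := leP (cl j x) (cl j y); first exact: wl.
    by move=> /wl; rewrite distrC (distrC x).
  apply: le_trans (energy_modulus (uM n) e0 (cl0 j x) xy (cll j y)) _.
  rewrite ler_pM2r ?invr_gt0// lerD2l ler_pM2r ?invr_gt0//.
  exact: le_trans (ler_norm _) (cl_lip _ _ _).
have mod1 n j x y : 0 <= x <= l j -> 0 <= y <= l j ->
    `|val0 (u n) j y - val0 (u n) j x| <= (M + l j) / 2.
  move=> /andP[x0 xl] /andP[y0 yl].
  have := mod n j x y 1 ltr01; rewrite !clid// => /le_trans; apply.
  rewrite mul1r divr1 ler_pM2r ?invr_gt0// lerD2l ler_norml.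
  by apply/andP; split; lra.
(* by connectedness, the functions are uniformly bounded at each vertex *)
have bV k : exists C, forall n, `|valV (u n) (src k)| <= C.
  apply: (conn (S := fun v => exists C, forall n, `|valV (u n) v| <= C)
    _ (j := j0)); last by exists 0 => n; rewrite un0 normr0.
  have step j n : `|valV (u n) (tgt j) - valV (u n) (src j)| <= (M + l j) / 2.
    by rewrite -val_src -val_tgt; apply: mod1; rewrite lexx l_ge0.
  move=> j; split => -[C hC]; exists (C + (M + l j) / 2) => n.
    rewrite -[valV _ _](subrK (valV (u n) (src j))) addrC.
    by apply: le_trans (ler_normD _ _) _; rewrite lerD.
  rewrite -[valV _ _](subrK (valV (u n) (tgt j))) addrC.
  by apply: le_trans (ler_normD _ _) _; rewrite lerD// distrC.
have bx j x : exists C, forall n, `|val0 (u n) j (cl j x)| <= C.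
  have [C hC] := bV j; exists (C + (M + l j) / 2) => n.
  rewrite -[val0 _ _ _](subrK (valV (u n) (src j))) addrC.
  apply: le_trans (ler_normD _ _) _; rewrite lerD// -val_src.
  by apply: mod1; rewrite ?lexx ?l_ge0 ?cl0 ?cll.
have [F [FU ooF]] := @ultraFilterLemma _ \oo _.
have /choice[w0 w0P] : forall jx : E * R, exists L : R,
    val0 (u n) jx.1 (cl jx.1 jx.2) @[n --> F] --> L.
  move=> [j x]; have [C hC] := bx j x.
  by have /cvg_ex := ultra_bounded_cvg FU hC.
pose w j x := w0 (j, x).
have wP j x : val0 (u n) j (cl j x) @[n --> F] --> w j x by exact: (w0P (j, x)).
have wmod j x y e : 0 < e -> `|w j y - w j x| <= (e * M + `|y - x| / e) / 2.
  move=> e0; apply: (cvgr_to_le (f := fun n =>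
    `|val0 (u n) j (cl j y) - val0 (u n) j (cl j x)|) (F := F)).
    by apply: cvg_norm; apply: cvgB; exact: wP.
  by apply: nearW => n; exact: mod.
(* the modulus tends to zero *)
have modS (eps : R) : 0 < eps -> exists2 d, 0 < d & exists2 e, 0 < e &
    forall h, h < d -> (e * M + h / e) / 2 < eps.
  move=> eps0; pose e := eps / (M + 1).
  have e0 : 0 < e by rewrite divr_gt0// ltr_wpDl.
  exists (eps * e); first exact: mulr_gt0.
  exists e => // h hd.
  have h1 : h / e < eps by rewrite ltr_pdivrMr.
  have h2 : e * M <= eps.
    rewrite /e mulrAC ler_pdivrMr ?ltr_wpDl//.
    by rewrite ler_pM2l// lerDl.
  lra.
have cw j : continuous (w j).
  move=> x; apply/cvgrPdist_lt => eps eps0.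
  have [d d0 [e e0 dP]] := modS _ eps0.
  have : nbhs x (ball x d) by exact: nbhsx_ballx.
  apply: filterS => y xy.
  by apply: le_lt_trans (wmod j y x e e0) (dP _ _); exact: xy.
exists F, w, (fun v => lim (valV (u n) v @[n --> F])); split => //.
- move=> j; split; apply/esym/cvg_lim => //.
    have := wP j 0; rewrite clid// => h.
    by under eq_fun do rewrite -val_src.
  have := wP j (l j); rewrite clid// => h.
  by under eq_fun do rewrite -val_tgt.
- move=> j x x0l; apply/cvgrPdist_lt => eps eps0.
  have e2 : 0 < eps / 2 by rewrite divr_gt0.
  have [d d0 [e e0 dP]] := modS _ e2.
  have h1 : \forall y \near x, `|x - y| < d by exact: nbhsx_ballx.
  have /cvgrPdist_lt/(_ _ e2) h2 := wP j x.
  exists ([set y | `|x - y| < d],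
    [set n | `|w j x - val0 (u n) j (cl j x)| < eps / 2]) => //.
  move=> [y n] [/= hy hn].
  have := le_lt_trans (mod n j y x e e0) (dP _ hy).
  rewrite -/(cl j y).
  rewrite (_ : w j x - val0 (u n) j (cl j y) = (w j x - val0 (u n) j (cl j x)) +
    (val0 (u n) j (cl j x) - val0 (u n) j (cl j y))); last by ring.
  move=> hyx; apply: le_lt_trans (ler_normD _ _) _.
  by rewrite [ltRHS](splitr eps) ltrD.
Qed.

(** * The constrained minimisation problem *)

Section Sufficiency.
Variable H : E -> R -> R.
Hypothesis cH : forall j, continuous (H j).

(** The weighted mass of exp(w); the constraint is that it be nonnegative. *)
Definition mass (w : E -> R -> R) : R :=
  graph_integral (fun j y => H j y * expR (w j y)).

(** The derivative of the mass at [w] in the direction [phi]. *)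
Definition dmass (w : E -> R -> R) (phi : c2fun) : R :=
  graph_integral (fun j y => H j y * expR (w j y) * val0 phi j y).

Lemma mass_shift u c :
  mass (val0 (c2comb u c (c2cst 1))) = expR c * mass (val0 u).
Proof.
rewrite /mass -graph_integralZ; last by solve_continuous.
congr graph_integral; apply/funext => j; apply/funext => y /=.
by rewrite mulr1 expRD; ring.
Qed.

Lemma energy_shift u c : energy (c2comb u c (c2cst 1)) = energy u.
Proof.
congr graph_integral; apply/funext => j; apply/funext => y /=.
by rewrite mulr0 addr0.
Qed.

Hypothesis H_pos : exists j y, 0 < y < l j /\ 0 < H j y.

(** A nonzero bump function supported where [H] is positive. *)
Lemma bump_pos : exists phi : c2fun, [/\ forall j y, 0 <= val0 phi j y,
  forall j y, 0 < val0 phi j y -> 0 < H j y &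
  exists j y, 0 < y < l j /\ 0 < val0 phi j y].
Proof.
have [j [c [/andP[c0 cl] Hc]]] := H_pos.
have : \forall z \near c, 0 < H j z.
  have /cvgr_gt : H j z @[z --> c] --> H j c by exact: cH.
  exact.
move=> /nbhs_ballP[e /= e0 He].
pose d := Num.min (e / 2) (Num.min (c / 2) ((l j - c) / 2)).
have d0 : 0 < d by rewrite !lt_min !divr_gt0// subr_gt0.
have de : d <= e / 2 by rewrite ge_min lexx.
have dc : d <= c / 2 by rewrite !ge_min lexx orbT.
have dl : d <= (l j - c) / 2 by rewrite !ge_min lexx !orbT.
have [|||phi [p1 p0]] := @bump_on_edge j (c - d) (c + d); [lra|lra|lra|].
exists phi; split.
- move=> k z; have [/p1/ltW//|/p0 ->//] := boolP ((k == j) && (c - d < z < c + d)).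
- move=> k z; have [/andP[/eqP -> /andP[z1 z2]] _|/p0 ->] :=
    boolP ((k == j) && (c - d < z < c + d)); last by rewrite ltxx.
  by apply: He; rewrite /ball/= ltr_norml; apply/andP; split; lra.
- exists j, c; rewrite c0 cl; split => //; apply: p1; rewrite eqxx/=.
  by apply/andP; split; lra.
Qed.

Lemma bump_weighted_pos (w : E -> R -> R) (phi : c2fun) :
  (forall j, continuous (w j)) -> (forall j y, 0 < w j y) ->
  (forall j y, 0 <= val0 phi j y) ->
  (forall j y, 0 < val0 phi j y -> 0 < H j y) ->
  (exists j y, 0 < y < l j /\ 0 < val0 phi j y) ->
  0 < graph_integral (fun j y => H j y * w j y * val0 phi j y).
Proof.
move=> cw w0 p0 pH [j [y [y0l py]]].
have c : forall j, continuous (fun y => H j y * w j y * val0 phi j y).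
  by solve_continuous.
have q0 k z : 0 < z < l k -> 0 <= H k z * w k z * val0 phi k z.
  move=> _; have [pz|] := ltP 0 (val0 phi k z).
    by rewrite !mulr_ge0// ltW// pH.
  by rewrite le_eqVlt ltNge p0 orbF => /eqP ->; rewrite mulr0.
rewrite lt_neqAle graph_integral_ge0// andbT; apply/negP => /eqP/esym I0.
have /eqP := graph_integral_eq0 c q0 I0 y0l.
by rewrite !mulf_eq0 !gt_eqF// pH.
Qed.

Lemma feasible : exists u : c2fun, 0 <= mass (val0 u).
Proof.
have [phi [p0 pH pe]] := bump_pos.
have cst1 : forall j, continuous ((fun _ _ => 1) j : R -> R).
  by move=> _ x; exact: cvg_cst.
have := @bump_weighted_pos (fun _ _ => 1) phi cst1
  (fun _ _ => ltr01) p0 pH pe.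
set I := graph_integral _ => I0.
have IE : I = graph_integral (fun j y => H j y * val0 phi j y).
  by congr graph_integral; apply/funext => j; apply/funext => y; rewrite mulr1.
pose t := `|graph_integral H| / I.
have t0 : 0 <= t by rewrite divr_ge0// ltW.
exists (c2comb (c2cst 0) t phi).
apply: (@le_trans _ _ (graph_integral H + t * I)).
  by rewrite /t divfK ?gt_eqF// -lerBlDl sub0r -normrN ler_norm.
rewrite IE -graph_integralZ -?graph_integralD; try by solve_continuous.
apply: le_graph_integral; try by solve_continuous.
move=> j y _ /=; rewrite add0r.
have [pz|] := ltP 0 (val0 phi j y); last first.
  rewrite le_eqVlt ltNge p0 orbF => /eqP ->.
  by rewrite !mulr0 expR0 mulr1 addr0.
rewrite mulrCA -{1}[H j y]mulr1 -mulrDr ler_pM2l ?pH//.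
exact: expR_ge1Dx.
Qed.

(** A sequence of admissible functions whose energies tend to the infimum [m],
    normalised to vanish at a given vertex. *)
Lemma minimizing_sequence (v0 : V) : exists (u : nat -> c2fun) (m : R),
  [/\ forall n, 0 <= mass (val0 (u n)),
      forall n, energy (u n) <= m + n.+1%:R^-1,
      forall u, 0 <= mass (val0 u) -> m <= energy u &
      forall n, valV (u n) v0 = 0].
Proof.
pose S := [set energy u | u in [set u | 0 <= mass (val0 u)]].
have lbS : has_lbound S by exists 0 => _ [u _ <-]; exact: energy_ge0.
have iS : has_inf S.
  by split => //; have [u hu] := feasible; exists (energy u), u.
have /choice[u uP] : forall n : nat, exists u, [/\ 0 <= mass (val0 u),
    energy u <= inf S + n.+1%:R^-1 & valV u v0 = 0].
  move=> n; have n0 : 0 < n.+1%:R^-1 :> R by rewrite invr_gt0.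
  have [_ [u hu <-] ui] := inf_adherent n0 iS.
  exists (c2comb u (- valV u v0) (c2cst 1)).
  rewrite mass_shift energy_shift mulr_ge0 ?expR_ge0// ltW//=.
  by rewrite mulr1 subrr.
exists u, (inf S); split => [n|n|w hw|n]; try by case: (uP n).
by apply: ge_inf => //; exists w.
Qed.

(** The bilinear form [bilin w phi], integrated by parts so as to make sense for
    [w] merely continuous. *)
Definition weak_bilin (w : E -> R -> R) (phi : c2fun) : R :=
  bdry w (val1 phi) - graph_integral (fun j y => w j y * val2 phi j y).

Lemma dmass_comb w phi c psi : (forall j, continuous (w j)) ->
  dmass w (c2comb phi c psi) = dmass w phi + c * dmass w psi.
Proof.
move=> cw; rewrite /dmass -graph_integralZ -?graph_integralD; try by solve_continuous.
by congr graph_integral; apply/funext => j; apply/funext => y /=; ring.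
Qed.

Lemma weak_bilin_comb w phi c psi : (forall j, continuous (w j)) ->
  weak_bilin w (c2comb phi c psi) = weak_bilin w phi + c * weak_bilin w psi.
Proof.
move=> cw; rewrite /weak_bilin.
have -> : bdry w (val1 (c2comb phi c psi)) =
    bdry w (val1 phi) + c * bdry w (val1 psi).
  rewrite /bdry mulr_sumr -big_split; apply: eq_bigr => j _ /=; ring.
have -> : graph_integral (fun j y => w j y * val2 (c2comb phi c psi) j y) =
    graph_integral (fun j y => w j y * val2 phi j y) +
    c * graph_integral (fun j y => w j y * val2 psi j y).
  rewrite -graph_integralZ -?graph_integralD; try by solve_continuous.
  by congr graph_integral; apply/funext => j; apply/funext => y /=; ring.
ring.
Qed.

(** Lagrange multiplier rule for one inequality constraint. *)
Lemma lagrange_multiplier (A B : c2fun -> R) (phi0 : c2fun) :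
  (forall phi c psi, A (c2comb phi c psi) = A phi + c * A psi) ->
  (forall phi c psi, B (c2comb phi c psi) = B phi + c * B psi) ->
  0 < A phi0 -> (forall phi, 0 < A phi -> 0 <= B phi) ->
  exists2 mu, 0 <= mu & forall phi, B phi = mu * A phi.
Proof.
move=> linA linB A0 AB; pose mu := B phi0 / A phi0.
have B0 : 0 <= B phi0 by exact: AB.
have half psi : mu * A psi <= B psi.
  apply/ler_addgt0Pr => e e0.
  (* psi is moved along phi0 until the constraint has a small positive
     derivative *)
  pose d := e / (B phi0 + 1).
  have B1 : 0 < B phi0 + 1 by rewrite ltr_wpDl.
  have d0 : 0 < d by rewrite divr_gt0.
  have := AB (c2comb psi (d - A psi / A phi0) phi0).
  rewrite linA linB.
  have -> : A psi + (d - A psi / A phi0) * A phi0 = d * A phi0.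
    by field; rewrite gt_eqF.
  rewrite mulr_gt0// => /(_ isT).
  have -> : B psi + (d - A psi / A phi0) * B phi0 =
      B psi - mu * A psi + d * B phi0.
    by rewrite /mu; field; rewrite gt_eqF.
  have : d * B phi0 <= e by rewrite /d mulrAC ler_pdivrMr// ler_pM2l//; lra.
  lra.
exists mu; first by rewrite divr_ge0// ltW.
move=> phi; apply/eqP; rewrite eq_le half andbT.
(* phi - 2 phi is the opposite of phi *)
have := half (c2comb phi (- 2) phi); rewrite linA linB; lra.
Qed.

(** If the mass is nonnegative and its derivative in the direction [phi] is
    positive, small displacements in that direction are admissible. *)
Lemma mass_increases w phi : (forall j, continuous (w j)) -> 0 <= mass w ->
  0 < dmass w phi -> exists2 t0, 0 < t0 & forall t, 0 < t -> t <= t0 ->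
    0 < mass (fun j y => w j y + t * val0 phi j y).
Proof.
move=> cw m0 A0.
have /choice[K KP] : forall j, exists K, forall y, 0 <= y <= l j ->
    `|val0 phi j y| <= K.
  move=> j; have cn : {within `[0, l j], continuous (fun y => `|val0 phi j y|)}.
    apply: continuous_subspaceT => y.
    by apply: (@cvg_norm _ R^o); exact: continuous_val0.
  have [c _ cP] := EVT_max (l_ge0 j) cn.
  by exists (`|val0 phi j c|) => y yl; apply: cP; rewrite in_itv.
have K0 j : 0 <= K j by apply: le_trans (KP j 0 _); rewrite // lexx l_ge0.
pose K1 := 1 + \sum_j K j.
have K1P j y : 0 < y < l j -> `|val0 phi j y| <= K1.
  move=> /andP[y0 yl]; apply: (@le_trans _ _ (K j)); first by apply: KP; lra.
  by rewrite /K1 (bigD1 j)//= addrCA lerDl addr_ge0// sumr_ge0.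
have K10 : 0 < K1 by rewrite ltr_pwDl// sumr_ge0.
pose q j y := `|H j y| * expR (w j y) * (2 * (val0 phi j y * val0 phi j y)).
have cq j : continuous (q j).
  have : continuous (fun y => `|H j y|).
    by move=> y; apply: (@cvg_norm _ R^o); exact: cH.
  by move=> cn; rewrite /q; solve_continuous.
have Q0 : 0 <= graph_integral q.
  apply: graph_integral_ge0 => // j y _.
  apply: mulr_ge0; first by rewrite mulr_ge0 ?expR_ge0.
  by apply: mulr_ge0 => //; rewrite -expr2 sqr_ge0.
pose t0 := Num.min (1 / 2 / K1) (dmass w phi / (graph_integral q + 1)).
have Q1 : 0 < graph_integral q + 1 by rewrite ltr_wpDl.
exists t0; first by rewrite /t0 lt_min !divr_gt0.
move=> t tpos; rewrite /t0 le_min => /andP[tK tQ].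
apply: (@lt_le_trans _ _ (mass w + (t * dmass w phi + - (t ^+ 2 * graph_integral q)))).
  apply: ltr_wpDl => //.
  have -> : t * dmass w phi + - (t ^+ 2 * graph_integral q) =
    t * (dmass w phi - t * graph_integral q) by ring.
  rewrite mulr_gt0// subr_gt0.
  apply: (@lt_le_trans _ _ (t * (graph_integral q + 1))).
    by rewrite ltr_pM2l// ltrDl.
  by rewrite -ler_pdivlMr.
rewrite /mass /dmass -!graph_integralZ//; try by solve_continuous.
rewrite -graph_integralN -?graph_integralD; try by solve_continuous.
apply: le_graph_integral; try by solve_continuous.
move=> j y yl; rewrite /q expRD.
set x := t * val0 phi j y.
have x12 : `|x| <= 1 / 2.
  rewrite /x normrM (gtr0_norm tpos).
  apply: (@le_trans _ _ (t * K1)); first by rewrite ler_pM2l// K1P.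
  by rewrite -ler_pdivlMr.
have lo := expR_ge1Dx x; have hi := expR_le_quad x12.
rewrite -subr_ge0.
have -> : H j y * (expR (w j y) * expR x) - (H j y * expR (w j y) +
    (t * (H j y * expR (w j y) * val0 phi j y) +
     - (t ^+ 2 * (`|H j y| * expR (w j y) * (2 * (val0 phi j y * val0 phi j y))))))
  = expR (w j y) * (H j y * (expR x - (1 + x)) + `|H j y| * (2 * x ^+ 2)).
  by rewrite /x; ring.
rewrite mulr_ge0 ?expR_ge0//.
have h1 : - (`|H j y| * (expR x - (1 + x))) <= H j y * (expR x - (1 + x)).
  by rewrite -mulNr ler_wpM2r ?subr_ge0// lerNl -normrN ler_norm.
have h2 : `|H j y| * (expR x - (1 + x)) <= `|H j y| * (2 * x ^+ 2).
  by rewrite ler_wpM2l//; lra.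
lra.
Qed.

Section LimitPassage.
Variables (F : set_system nat) (FF : ProperFilter F) (u : nat -> c2fun).
Variable w : E -> R -> R.
Hypothesis cw : forall j, continuous (w j).
Hypothesis uw : forall j x, 0 <= x <= l j ->
  val0 (u p.2) j (clamp (l j) p.1) @[p --> filter_prod (nbhs x) F] --> w j x.

Let cfst (f : R -> R) x : continuous f ->
  f p.1 @[p --> filter_prod (nbhs x) F] --> f x.
Proof.
by move=> cf; apply: (cvg_comp _ _ (@cvg_fst _ _ (nbhs x) F _)); exact: cf.
Qed.

Let cu n j : continuous (fun y => val0 (u n) j (clamp (l j) y)).
Proof.
move=> y; apply: (@continuous_comp _ _ _ (clamp (l j)) (val0 (u n) j)).
  exact: continuous_clamp.
exact: continuous_val0.
Qed.

Let clampE j y : 0 < y < l j -> clamp (l j) y = y.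
Proof. by move=> /andP[y0 yl]; rewrite clamp_id// !ltW. Qed.

Lemma mass_cvg t phi : mass (val0 (c2comb (u n) t phi)) @[n --> F] -->
  mass (fun j y => w j y + t * val0 phi j y).
Proof.
have cu' := cu.
have -> : (fun n => mass (val0 (c2comb (u n) t phi))) = fun n =>
    graph_integral (fun j y => H j y *
      expR (val0 (u n) j (clamp (l j) y) + t * val0 phi j y)).
  apply/funext => n; apply: eq_graph_integral; try by solve_continuous.
  by move=> j y /clampE -> /=.
apply: graph_integral_cvg; try by solve_continuous.
move=> j x xl; apply: cvgM; first exact: cfst.
apply: continuous_cvg; first exact: continuous_expR.
apply: cvgD; first exact: uw.
by apply: cvgM; [exact: cvg_cst|exact: cfst].
Qed.

Lemma bilin_cvg phi : bilin (u n) phi @[n --> F] --> weak_bilin w phi.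
Proof.
have cu' := cu.
have -> : (fun n => bilin (u n) phi) = fun n => bdry (val0 (u n)) (val1 phi) -
    graph_integral (fun j y => val0 (u n) j (clamp (l j) y) * val2 phi j y).
  apply/funext => n; rewrite green_formula; congr (_ - _).
  apply: eq_graph_integral; try by solve_continuous.
  by move=> j y /clampE ->.
have pt j x : 0 <= x <= l j -> val0 (u n) j x @[n --> F] --> w j x.
  move=> xl; rewrite -{1}(clamp_id xl).
  apply: (cvg_comp (fun n => (x, n)) _ _ (uw xl)).
  move=> A [[P Q] /= [xP FQ] PQ]; apply: filterS FQ => n Qn.
  by apply: PQ; split => //=; exact: nbhs_singleton.
apply: cvgB.
  apply: cvg_big; first exact: add_continuous.
  move=> j _; apply: cvgB; apply: cvgM; try exact: cvg_cst.
    by apply: pt; rewrite lexx l_ge0.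
  by apply: pt; rewrite lexx l_ge0.
apply: graph_integral_cvg; try by solve_continuous.
move=> j x xl; apply: cvgM; first exact: uw.
by apply: cfst; exact: continuous_val2.
Qed.

End LimitPassage.

(** The limit of a minimizing sequence is a weak solution of the equation, up to
    a nonnegative Lagrange multiplier. *)
Lemma weak_solution : exists (w : E -> R -> R) (wV : V -> R) (mu : R),
  [/\ forall j, continuous (w j),
    forall j, w j 0 = wV (src j) /\ w j (l j) = wV (tgt j), 0 <= mass w,
    0 <= mu & forall phi, weak_bilin w phi = mu * dmass w phi].
Proof.
have [j0 _] := H_pos.
have [u [m [um ue mle u0]]] := minimizing_sequence (src j0).
have uM n : energy (u n) <= m + 1.
  by apply: le_trans (ue n) _; rewrite lerD2l invf_le1// ler1n.
have [F [w [wV [FU ooF cw we uw]]]] := energy_compactness uM u0.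
have FF : ProperFilter F := @ultra_proper _ F FU.
have m0 : 0 <= mass w.
  have h := @mass_cvg F FF u w cw uw 0 (c2cst 0).
  have -> : w = fun j y => w j y + 0 * val0 (c2cst 0) j y.
    by apply/funext => j; apply/funext => y; rewrite mul0r addr0.
  apply: (cvgr_to_ge h); apply: nearW => n.
  have -> : val0 (c2comb (u n) 0 (c2cst 0)) = val0 (u n); last exact: um.
  by apply/funext => j; apply/funext => y /=; rewrite mul0r addr0.
have [phi0 [p0 pH pe]] := bump_pos.
have A0 : 0 < dmass w phi0.
  apply: (@bump_weighted_pos (fun j y => expR (w j y))) => //.
    by solve_continuous.
  by move=> j y; exact: expR_gt0.
have AB phi : 0 < dmass w phi -> 0 <= weak_bilin w phi.
  move=> Aphi; have [t0 t00 tP] := mass_increases cw m0 Aphi.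
  (* the energies of u n + t phi are at least the infimum *)
  have step t : 0 < t -> t <= t0 ->
      0 <= 2 * t * weak_bilin w phi + t ^+ 2 * energy phi.
    move=> tpos tle.
    have : (n.+1%:R^-1 + (2 * t * bilin (u n) phi + t ^+ 2 * energy phi))
        @[n --> F] --> 0 + (2 * t * weak_bilin w phi + t ^+ 2 * energy phi).
      apply: cvgD.
        by move=> A hA; apply: ooF; exact: (@cvg_harmonic R A hA).
      apply: cvgD; last exact: cvg_cst.
      by apply: cvgM; [exact: cvg_cst|exact: (@bilin_cvg F FF u w cw uw)].
    rewrite add0r => h; apply: (cvgr_to_ge h).
    have /cvgr_gt/(_ _ (tP t tpos tle)) := @mass_cvg F FF u w cw uw t phi.
    apply: filterS => n /ltW /mle; rewrite energy_comb => h1 /=.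
    move: (ue n) h1; move: (n.+1%:R^-1 : R) (energy (u n)) => k eu.
    by move: (_ + t ^+ 2 * _) => x; lra.
  apply/ler_addgt0Pr => e e0.
  pose t := Num.min t0 (e / (energy phi + 1)).
  have E1 : 0 < energy phi + 1 by rewrite ltr_wpDl// energy_ge0.
  have tpos : 0 < t by rewrite lt_min t00 divr_gt0.
  have := step t tpos; rewrite ge_min lexx => /(_ isT).
  have te : t * energy phi <= e.
    apply: (@le_trans _ _ (t * (energy phi + 1))).
      by rewrite ler_pM2l// lerDl.
    by rewrite -ler_pdivlMr// ge_min lexx orbT.
  have -> : 2 * t * weak_bilin w phi + t ^+ 2 * energy phi =
    t * (2 * weak_bilin w phi + t * energy phi) by ring.
  rewrite pmulr_rge0//; lra.
have [mu mu0 muP] := lagrange_multiplier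
  (fun phi c psi => dmass_comb phi c psi cw)
  (fun phi c psi => weak_bilin_comb phi c psi cw) A0 AB.
by exists w, wV, mu.
Qed.

(** A continuous weak solution of u'' = - mu H exp(u) is of class C^2 and
    satisfies Kirchhoff's law. *)
Lemma weak_solution_regular w wV mu : (forall j, continuous (w j)) ->
  (forall j, w j 0 = wV (src j) /\ w j (l j) = wV (tgt j)) ->
  (forall phi, weak_bilin w phi = mu * dmass w phi) ->
  exists v : c2fun, [/\ forall j y, 0 < y < l j -> val0 v j y = w j y,
    forall j y, val2 v j y = - (mu * (H j y * expR (w j y))) &
    kirchhoff (val1 v)].
Proof.
move=> cw we weak.
pose g j y := - (mu * (H j y * expR (w j y))).
have cg j : continuous (g j) by rewrite /g; solve_continuous.
pose v := dirichlet cg wV.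
pose d j y := w j y + - val0 v j y.
have cd j : continuous (d j) by rewrite /d; solve_continuous.
have bw a : bdry w a = bdry (val0 v) a.
  apply: eq_bigr => j _; have [-> ->] := we j.
  by rewrite (val_src v) (val_tgt v).
(* tested with phi, the weak equation compares w with the solution v of the
   Dirichlet problem with the same right-hand side and vertex values *)
have key (phi : c2fun) : \sum_j (val1 v j (l j) * valV phi (tgt j) -
    val1 v j 0 * valV phi (src j)) =
    graph_integral (fun j y => d j y * val2 phi j y).
  have E1 : graph_integral (fun j y => w j y * val2 phi j y) =
      graph_integral (fun j y => d j y * val2 phi j y) +
      graph_integral (fun j y => val0 v j y * val2 phi j y).
    rewrite -graph_integralD; try by solve_continuous.
    by congr graph_integral; apply/funext => j; apply/funext => y; rewrite /d; ring.
  have E2 : graph_integral (fun j y => val0 phi j y * val2 v j y) =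
      - (mu * dmass w phi).
    rewrite /dmass -graph_integralZ -?graph_integralN; try by solve_continuous.
    by congr graph_integral; apply/funext => j; apply/funext => y; rewrite /= /g; ring.
  have E3 : bilin v phi = bilin phi v.
    by congr graph_integral; apply/funext => j; apply/funext => y; rewrite mulrC.
  have E4 : \sum_j (val1 v j (l j) * valV phi (tgt j) -
      val1 v j 0 * valV phi (src j)) = bdry (val0 phi) (val1 v).
    apply: eq_bigr => j _; rewrite -val_src -val_tgt.
    by congr (_ - _); rewrite mulrC.
  have := weak phi; rewrite /weak_bilin bw E1 E4.
  by have := green_formula v phi; have := green_formula phi v; rewrite E2 E3; lra.
(* test functions with second derivative d and zero vertex values *)
have d0 : forall j y, 0 < y < l j -> d j y = 0.
  have dd0 : graph_integral (fun j y => d j y * d j y) = 0.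
    by rewrite -(key (dirichlet cd (fun=> 0))) big1// => j _ /=; ring.
  move=> j y yl; apply/eqP; rewrite -[_ == 0]orbb -mulf_eq0; apply/eqP.
  apply: (graph_integral_eq0 _ _ dd0 yl) => [|k z _]; first by solve_continuous.
  by rewrite -expr2 sqr_ge0.
exists v; split => //.
  by move=> j y /d0; rewrite /d; lra.
move=> a.
have cz (j : E) : continuous (fun _ : R => 0 : R) by solve_continuous.
by rewrite (key (dirichlet cz a)) graph_integral0// => j y /=; rewrite mulr0.
Qed.

Hypothesis H_neg : graph_integral H < 0.

(** With a zero multiplier the solution would be harmonic, hence constant. *)
Lemma multiplier_gt0 v w mu : (forall j, continuous (w j)) -> 0 <= mass w ->
  (forall j y, 0 < y < l j -> val0 v j y = w j y) -> 0 <= mu ->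
  (forall j y, val2 v j y = - (mu * (H j y * expR (w j y)))) ->
  kirchhoff (val1 v) -> 0 < mu.
Proof.
move=> cw m0 vw mu0 v2 kv; rewrite lt_neqAle mu0 andbT; apply/negP => /eqP mu00.
have v20 j y : val2 v j y = 0 by rewrite v2 -mu00 mul0r oppr0.
have en0 : energy v = 0.
  have := green_formula v v; rewrite -/(energy v).
  have -> : bdry (val0 v) (val1 v) = 0.
    rewrite -[RHS](kv (valV v)); apply: eq_bigr => j _.
    by rewrite -val_src -val_tgt; congr (_ - _); rewrite mulrC.
  have -> : graph_integral (fun j y => val0 v j y * val2 v j y) = 0.
    by apply: graph_integral0 => j y; rewrite v20 mulr0.
  by rewrite subr0.
(* a function of zero energy has a zero modulus of continuity *)
have v0c j y : 0 <= y -> y <= l j -> val0 v j y = val0 v j 0.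
  move=> y0 yl; apply/eqP; rewrite -subr_eq0 -normr_le0; apply/ler_addgt0Pr => e e0.
  have e20 : 0 < (l j / e) by rewrite divr_gt0.
  have := @energy_modulus v 0 (l j / e) 0 y j _ e20 (lexx _) y0 yl.
  rewrite en0 lexx mulr0 add0r subr0 add0r => /(_ isT) h; apply: le_trans h _.
  rewrite invf_div mulrA; rewrite ler_pdivrMr// ler_pdivrMr//.
  nra.
have [j0 _] := H_pos.
have vc j y : 0 < y < l j -> w j y = valV v (src j0).
  move=> /[dup] /andP[y0 yl] yl'; rewrite -vw// v0c ?ltW// val_src.
  apply: (conn (S := fun x => valV v x = valV v (src j0)) _ (j := j0)) => // k.
  by rewrite -val_src -val_tgt (v0c k (l k)).
have : mass w = expR (valV v (src j0)) * graph_integral H.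
  rewrite -graph_integralZ//; apply: eq_graph_integral; try by solve_continuous.
  by move=> j y yl; rewrite vc// mulrC.
by move=> mE; move: m0; rewrite mE pmulr_rge0 ?expR_gt0// leNgt H_neg.
Qed.

Lemma kazdan_warner_existence : exists u : c2fun,
  (forall j y, 0 < y < l j -> val2 u j y = - (H j y * expR (val0 u j y))) /\
  kirchhoff (val1 u).
Proof.
have [w [wV [mu [cw we m0 mu0 weak]]]] := weak_solution.
have [v [vw v2 kv]] := weak_solution_regular cw we weak.
have mup := multiplier_gt0 cw m0 vw mu0 v2 kv.
exists (c2comb v (ln mu) (c2cst 1)); split.
  move=> j y yl; rewrite /= v2 mulr0 addr0 mulr1 expRD lnK ?posrE// vw//.
  by congr (- _); ring.
by move=> a; rewrite -[RHS](kv a); apply: eq_bigr => j _ /=; rewrite !mulr0 !addr0.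
Qed.

End Sufficiency.

End MetricGraph.

(** * Topology of the network *)

Section Geometry.
Variables (R : realType) (n : nat) (G : network R n).
Implicit Types (j k : edge G) (i : vertex G) (x : 'rV[R]_n) (y z c : R).

Let src j := par j 0.
Let tgt j := par j (len j).

Lemma len_ge0 j : 0 <= len j. Proof. exact/ltW/len_gt0. Qed.

Lemma par_inj j y z : 0 <= y <= len j -> 0 <= z <= len j ->
  par j y = par j z -> y = z.
Proof. by move=> yl zl; apply: par_injective; rewrite inE/= in_itv. Qed.

Lemma edge_coordK j y : 0 <= y <= len j -> edge_coord j (par j y) = y.
Proof.
by move=> yl; apply: (pinvKV _ (@par_injective _ _ G j)); rewrite inE/= in_itv.
Qed.

(** An edge together with its end points. *)
Definition closed_edge j : set 'rV[R]_n := par j @` `[0, len j].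

Lemma compact_par j (K : set R) : compact K -> K `<=` `[0, len j]%classic ->
  compact (par j @` K).
Proof.
move=> cK Kl; apply: continuous_compact => //.
exact: continuous_subspaceW Kl (@par_continuous _ _ G j).
Qed.

Lemma closed_par j (K : set R) : compact K -> K `<=` `[0, len j]%classic ->
  closed (par j @` K).
Proof.
by move=> cK Kl; apply: compact_closed; [exact: norm_hausdorff|exact: compact_par].
Qed.

Lemma closed_closed_edge j : closed (closed_edge j).
Proof. by apply: closed_par => //; exact: segment_compact. Qed.

Lemma vertex_on_edge j y : 0 <= y <= len j -> range (@vert _ _ G) (par j y) ->
  y = 0 \/ y = len j.
Proof.
move=> /andP[y0 yl] vy.
move: y0 yl; rewrite !le_eqVlt => /predU1P[<-|y0]; first by left.
move=> /predU1P[->|yl]; first by right.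
by have := @par_interior _ _ G j y; rewrite y0 yl => /(_ isT vy).
Qed.

(** Two parametrized points that coincide are the same point of the same edge,
    or are end points of edges. *)
Lemma par_eq j k y z : 0 <= y <= len j -> 0 <= z <= len k ->
  par j y = par k z ->
  (j = k /\ y = z) \/ ((y = 0 \/ y = len j) /\ (z = 0 \/ z = len k)).
Proof.
move=> yl zl yz; have [jk|jk] := eqVneq j k.
  by left; subst k; split => //; exact: par_inj yz.
have v : range (@vert _ _ G) (par j y).
  apply: (edges_meet_at_vertices jk); split.
    by exists y => //; rewrite /= in_itv.
  by exists z; [rewrite /= in_itv|rewrite yz].
by right; split; [|rewrite yz in v]; exact: vertex_on_edge v.
Qed.

Hypothesis conn : connected (network_support G).

(** A family of closed edges that does not meet the other ones is, with the
    points of the support away from it, a decomposition of the support into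
    two closed sets, so by connectedness it covers the support. *)
Lemma support_sub_edges (P : edge G -> Prop) : (exists j, P j) ->
  (forall j k, P j -> ~ P k -> closed_edge j `&` closed_edge k = set0) ->
  network_support G `<=` \bigcup_(j in [set j | P j]) closed_edge j.
Proof.
move=> [j0 Pj0] disj.
set A := \bigcup_(j in [set j | P j]) closed_edge j.
pose B := \bigcup_(j in [set j | ~ P j]) closed_edge j `|`
  \bigcup_(i in [set i | ~ A (vert i)]) [set @vert _ _ G i].
have cA : closed A.
  apply: closed_bigcup; first exact: finite_finset.
  by move=> j _; exact: closed_closed_edge.
have cB : closed B.
  apply: closedU; apply: closed_bigcup; try exact: finite_finset.
    by move=> j _; exact: closed_closed_edge.
  move=> i _; apply: accessible_closed_set1.
  exact/hausdorff_accessible/norm_hausdorff.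
have AB x : A x -> ~ B x.
  move=> Ax [[k nPk kx]|[i nA]]; last by move=> /= xi; apply: nA; rewrite -xi.
  have [j Pj jx] := Ax; have : (closed_edge j `&` closed_edge k) x by [].
  by rewrite disj.
have sub j : closed_edge j `<=` network_support G.
  move=> x [y] /=; rewrite in_itv/= => /andP[y0 yl] <-.
  move: y0 yl; rewrite !le_eqVlt => /predU1P[<- _|y0].
    by left; exact: par_start.
  move=> /predU1P[->|yl]; first by left; exact: par_end.
  by right; exists j => //; exists y => //; rewrite /= in_itv/= y0.
have cover x : network_support G x -> A x \/ B x.
  move=> Zx; have [?|nAx] := pselect (A x); [by left|right].
  have [[i _ ix]|[j _ [y /=]]] := Zx.
    by right; exists i => //=; rewrite ix.
  rewrite in_itv/= => /andP[y0 yl] yx; left; exists j.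
    move=> /= Pj; apply: nAx; exists j => //; exists y => //.
    by rewrite /= in_itv/= !ltW.
  by exists y => //; rewrite /= in_itv/= !ltW.
have AE : A = network_support G `&` A.
  by apply/seteqP; split => [x Ax|x []//]; split => //; have [j _ /sub] := Ax.
rewrite -(conn (B := A)) //.
- exists (src j0), j0 => //; exists 0 => //.
  by rewrite /= in_itv/= lexx len_ge0.
- exists (~` B); first exact: closed_openC.
  apply/seteqP; split => x.
    by move=> Ax; split; [have [j _ /sub] := Ax|exact: AB].
  by move=> [Zx nBx]; have [] := cover x Zx.
- by exists A.
Qed.

(** There are no isolated vertices. *)
Lemma support_on_edge x : network_support G x ->
  exists j y, 0 <= y <= len j /\ par j y = x.
Proof.
move=> Zx.
have [j0 _] : exists j, j \in edge G by apply/card_gt0P; exact: edge_nonempty.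
have [||j _ [y yl yx]] := @support_sub_edges (fun=> True) _ _ x Zx.
- by exists j0.
- by [].
- by exists j, y; split => //; move: yl; rewrite /= in_itv.
Qed.

(** Topological connectedness of the support implies combinatorial
    connectedness, the vertices being identified with points. *)
Lemma network_connected (S : 'rV[R]_n -> Prop) :
  (forall j, S (src j) <-> S (tgt j)) -> forall j k, S (src j) -> S (src k).
Proof.
move=> st j k Sj.
have ends j' y : (y = 0 \/ y = len j') -> S (par j' y) <-> S (src j').
  by move=> [->|->] //; rewrite -/(tgt j') st.
have Zk : network_support G (src k) by left; exact: par_start.
have [||j' /= Sj' [y]] := @support_sub_edges (fun j => S (src j)) _ _ _ Zk.
- by exists j.
- move=> j1 k1 S1 nS1; apply/seteqP; split => // x [[y + <-] [z + zy]] /=.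
  rewrite /= !in_itv/= => yl zl.
  have [[jk _]|[/ends ye /ends ze]] := par_eq yl zl (esym zy).
    by rewrite jk in S1.
  by apply: nS1; apply/ze; rewrite zy; apply/ye.
rewrite /= in_itv/= => yl yk.
have [//|[jk _]|[/ends ye _]] := par_eq (z := 0) yl _ yk.
- by rewrite lexx len_ge0.
- by rewrite -jk.
- by rewrite -yk; apply/ye.
Qed.

Lemma edge_set_sub j x : edge_set j x -> exists2 y, 0 < y < len j & x = par j y.
Proof. by move=> [y /=]; rewrite in_itv/= => yl <-; exists y. Qed.

(** The coordinate on an edge is continuous up to the end points: a
    continuous injection of a compact segment is a homeomorphism onto its
    image. *)
Lemma edge_coord_cvg j c : 0 <= c <= len j ->
  edge_coord j x @[x --> within (edge_set j) (nbhs (par j c))] --> c.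
Proof.
move=> cl; apply/cvgrPdist_lt => e e0.
pose K := `[0, len j]%classic `&` [set y | e <= `|c - y|].
have cK : compact K.
  apply: compact_closedI; first exact: segment_compact.
  rewrite (_ : [set y | _] = (fun y => `|c - y|) @^-1` [set t | e <= t])//.
  apply: closed_comp; last exact: closed_ge.
  move=> y _; apply: (@cvg_norm _ R^o); apply: cvgB; [exact: cvg_cst|exact: cvg_id].
have ocK : open (~` (par j @` K)).
  by apply/closed_openC/closed_par => // y [].
have ncK : (~` (par j @` K)) (par j c).
  move=> [y [/=]]; rewrite in_itv/= => yl ey yc.
  by move: ey; rewrite (par_inj yl cl yc) subrr normr0 leNgt e0.
have : nbhs (par j c) (~` (par j @` K)) by exact: open_nbhs_nbhs.
apply: filterS => x nx /edge_set_sub[y /andP[y0 yl] xy].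
rewrite xy edge_coordK; last by rewrite !ltW.
rewrite ltNge; apply/negP => ey; apply: nx; rewrite xy; exists y => //.
by split => //=; rewrite in_itv/= !ltW.
Qed.

Lemma closure_edge_set j c : 0 <= c <= len j -> closure (edge_set j) (par j c).
Proof.
move=> cl B Bc.
have /subspace_continuousP/(_ c) := @par_continuous _ _ G j.
rewrite /= in_itv/= => /(_ cl _ Bc); rewrite /within/= => /nbhs_ballP[e /= e0 eB].
have l0 := len_gt0 j; have /andP[c0 c1] := cl.
(* move from c towards the midpoint of the edge *)
pose t := Num.min 1 (e / len j).
have t0 : 0 < t by rewrite lt_min ltr01 divr_gt0.
have t1 : t <= 1 by rewrite ge_min lexx.
have tl : t * len j <= e by rewrite -ler_pdivlMr// ge_min lexx orbT.
pose y := c + t * (len j / 2 - c).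
have tc : t * c <= c by rewrite ler_piMl.
have tlc : t * (len j - c) <= len j - c by rewrite ler_piMl// subr_ge0.
have tl0 : 0 < t * len j by rewrite mulr_gt0.
have y0 : 0 < y by rewrite /y; lra.
have yl : y < len j by rewrite /y; lra.
have tc0 : 0 <= t * c by rewrite mulr_ge0// ltW.
have tcl : t * c <= t * len j by rewrite ler_pM2l.
exists (par j y); split.
  by exists y => //=; rewrite in_itv/= y0.
apply: eB; last by rewrite in_itv/= !ltW.
by rewrite /ball/= /y ltr_norml; apply/andP; split; lra.
Qed.

(** At the end [c] of an edge, the absolute value in the difference quotient is
    [s * (y - c)], with [s] equal to 1 at the start and to -1 at the end. *)
Lemma oriented_derivativeE (u : 'rV[R]_n -> R) j i (f : R -> R) c s d :
  vert i = par j c -> 0 <= c <= len j ->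
  (forall y, 0 <= y <= len j -> on_edge u j y = f y) ->
  (forall y, 0 < y < len j -> y != c /\ `|y - c| = s * (y - c)) ->
  s * s = 1 -> is_derive c 1 f d -> oriented_derivative u j i = s * d.
Proof.
move=> ic cl uf ys ss [df dE].
have FF : ProperFilter (within (edge_set j) (nbhs (par j c))).
  by apply: within_nbhs_proper; exact: closure_edge_set.
rewrite /oriented_derivative /vertex_value ic edge_coordK// uf//.
apply: cvg_lim; first exact: norm_hausdorff.
have s0 : s != 0 by apply/eqP => s0; move: ss; rewrite s0 mul0r; lra.
have sV : s^-1 = s by apply: (mulfI s0); rewrite ss mulfV.
have quot : (f y - f c) / (y - c) @[y --> c^'] --> d.
  have hd : h^-1 *: (f (h *: 1 + c) - f c) @[h --> 0^'] --> d.
    by rewrite -dE; exact: df.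
  rewrite (_ : (fun y => _) = (fun h => h^-1 *: (f (h *: 1 + c) - f c)) \o
    (fun y => y - c)); last first.
    by apply/funext => y /=; rewrite /GRing.scale/= mulr1 subrK mulrC.
  apply: cvg_comp hd => A nA.
  have sc : y - c @[y --> c] --> (0 : R).
    by rewrite -(subrr c); apply: cvgB; [exact: cvg_id|exact: cvg_cst].
  have h1 : nbhs c [set y | y - c != 0 -> A (y - c)] by exact: (sc _ nA).
  change (nbhs c [set y | y != c -> A (y - c)]).
  by apply: filterS h1 => y h yc; apply: h; rewrite subr_eq0.
have lim1 : s * ((f (edge_coord j x) - f c) / (edge_coord j x - c))
    @[x --> within (edge_set j) (nbhs (par j c))] --> s * d.
  apply: cvgM; first exact: cvg_cst.
  apply: (@cvg_comp _ _ _ (@edge_coord _ _ G j)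
    (fun y => (f y - f c) / (y - c)) _ c^' _ _ quot) => A.
  move=> nA.
  have h1 : nbhs (par j c) [set x | edge_set j x -> edge_coord j x != c ->
      A (edge_coord j x)] by exact: (@edge_coord_cvg j c cl _ nA).
  change (nbhs (par j c) [set x | edge_set j x -> A (edge_coord j x)]).
  apply: filterS h1 => x h ex; apply: (h ex).
  have [y yl ->] := edge_set_sub ex.
  by rewrite edge_coordK ?(ys y yl).1//; case/andP: yl => *; rewrite !ltW.
apply: cvg_trans lim1; apply: near_eq_cvg.
rewrite near_withinE; apply: nearW => x /edge_set_sub[y yl ->].
have yl' : 0 <= y <= len j by case/andP: yl => *; rewrite !ltW.
rewrite edge_coordK// uf// (ys y yl).2 invfM sV.
by rewrite mulrCA.
Qed.

End Geometry.

(** * From the network to the metric graph *)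

Section Bridge.
Variables (R : realType) (n : nat) (G : network R n).
Implicit Types (j k : edge G) (i : vertex G) (u h : 'rV[R]_n -> R).

Let src j := par j 0.
Let tgt j := par j (len j).
Let len_gt0' : forall j, 0 < len j := @len_gt0 _ _ G.
Let l0 j : 0 <= len j. Proof. exact: len_ge0. Qed.

Local Notation c2net := (c2fun src tgt (@len _ _ G)).

(** The restriction of [u] to an edge, extended by constants to the line. *)
Definition clamped_edge u j (y : R) : R := on_edge u j (clamp (len j) y).

Lemma continuous_clamped_edge u j :
  {within `[0, len j], continuous (on_edge u j)} ->
  continuous (clamped_edge u j).
Proof. by move=> cu; apply: continuous_clampf. Qed.

Lemma clamped_edgeE u j y : 0 <= y <= len j -> clamped_edge u j y = u (par j y).
Proof. by move=> yl; rewrite /clamped_edge clamp_id. Qed.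

Lemma network_integralE h :
  (forall j, {within `[0, len j], continuous (on_edge h j)}) ->
  network_integral G h = graph_integral (@len _ _ G) (clamped_edge h).
Proof.
move=> ch; apply: eq_bigr => j _.
have cc := continuous_clamped_edge (ch j).
transitivity (\int[lebesgue_measure]_(r in `[0, len j]) clamped_edge h j r).
  apply: eq_Rintegral => y; rewrite inE/= in_itv/= => yl.
  by rewrite clamped_edgeE.
rewrite /Rintegral (@continuous_FTC2 _ _ (primitive (clamped_edge h j)))//.
- by rewrite primitive0// sube0.
- exact: continuous_subspaceT.
- have cp := continuous_primitive cc.
  split.
  + by move=> y _; have [] := is_derive_primitive y cc.
  + by apply: cvg_at_right_filter; exact: cp.
  + by apply: cvg_at_left_filter; exact: cp.
- move=> y _; rewrite derive1E; by have [_ ->] := is_derive_primitive y cc.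
Qed.

Lemma interior_pos (f : R -> R) (l y : R) : continuous f -> 0 < l ->
  0 <= y <= l -> 0 < f y -> exists2 z, 0 < z < l & 0 < f z.
Proof.
move=> cf l_gt0 /andP[y0 yl] fy.
have /cvgr_gt/(_ _ fy)/nbhs_ballP[e /= e0 He] : f z @[z --> y] --> f y.
  exact: cf.
pose t := Num.min 1 (e / l).
have t0 : 0 < t by rewrite lt_min ltr01 divr_gt0.
have t1 : t <= 1 by rewrite ge_min lexx.
have tl : t * l <= e by rewrite -ler_pdivlMr// ge_min lexx orbT.
have ty : t * y <= y by rewrite ler_piMl.
have tly : t * (l - y) <= l - y by rewrite ler_piMl// subr_ge0.
have tl0 : 0 < t * l by rewrite mulr_gt0.
have ty0 : 0 <= t * y by rewrite mulr_ge0// ltW.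
have tyl : t * y <= t * l by rewrite ler_pM2l.
exists (y + t * (l / 2 - y)).
  by apply/andP; split; lra.
by apply: He; rewrite /ball/= ltr_norml; apply/andP; split; lra.
Qed.

(** Kirchhoff's law at the listed vertices is equivalent to its weak form: the
    vertices are summed over as points, without repetition. *)
Lemma kirchhoffP (d : edge G -> R -> R) :
  kirchhoff src tgt (@len _ _ G) d <->
  forall i, \sum_(j | incident i j)
    (if vert i == src j then d j 0 else - d j (len j)) = 0.
Proof.
have st j : src j != tgt j.
  apply/eqP => e; have e0 : 0 = len j.
    by apply: (par_inj (j := j)) e; rewrite lexx l0.
  by have := len_gt0' j; rewrite -e0 ltxx.
have E (v : 'rV[R]_n) i : v = vert i -> \sum_(j | incident i j)
    (if vert i == src j then d j 0 else - d j (len j)) =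
    - \sum_j (d j (len j) * (tgt j == v)%:R - d j 0 * (src j == v)%:R).
  move=> ->; rewrite big_mkcond -sumrN; apply: eq_bigr => j _.
  rewrite /incident -/(src j) -/(tgt j) ![_ == vert i]eq_sym.
  have [->|_] /= := eqVneq (vert i) (src j).
    by rewrite (negbTE (st j)) mulr0 mulr1; ring.
  by case: eqP => _ /=; rewrite ?mulr0 ?mulr1; ring.
split=> [kd i|kd a].
  by rewrite (E _ i erefl) (kd (fun v => (v == vert i)%:R)) oppr0.
pose s := undup [seq vert i | i : vertex G].
have us : uniq s by exact: undup_uniq.
have aE (x : 'rV[R]_n) : range (@vert _ _ G) x ->
    a x = \sum_(v <- s) (x == v)%:R * a v.
  move=> [i _ ix]; have xs : x \in s.
    by rewrite mem_undup -ix map_f// mem_enum.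
  rewrite (bigD1_seq x)//= eqxx mul1r big1 ?addr0// => v.
  by rewrite eq_sym => /negbTE ->; rewrite mul0r.
transitivity (\sum_(v <- s) a v *
    \sum_j (d j (len j) * (tgt j == v)%:R - d j 0 * (src j == v)%:R)).
  rewrite (eq_bigr (fun v => \sum_j a v *
    (d j (len j) * (tgt j == v)%:R - d j 0 * (src j == v)%:R))); last first.
    by move=> v _; rewrite mulr_sumr.
  rewrite exchange_big; apply: eq_bigr => j _ /=.
  rewrite (aE (tgt j)) ?(aE (src j)); [|exact: par_start|exact: par_end].
  rewrite !mulr_sumr -sumrB; apply: eq_bigr => v _; ring.
rewrite big_seq big1// => v; rewrite mem_undup => /mapP[i _ vi].
by have := E _ i vi; rewrite kd => /eqP; rewrite eq_sym oppr_eq0 => /eqP ->;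
  rewrite mulr0.
Qed.

(** At an end point of an edge, the oriented derivative is the derivative at 0,
    or the opposite of the derivative at the other end. *)
Lemma oriented_derivative_end u (w : c2net) i j :
  (forall y, 0 <= y <= len j -> on_edge u j y = val0 w j y) ->
  incident i j -> oriented_derivative u j i =
    (if vert i == src j then val1 w j 0 else - val1 w j (len j)).
Proof.
move=> uw; have lj := len_gt0' j.
rewrite /incident -/(src j) -/(tgt j); have [ij _|_ /eqP ij] := eqVneq.
  rewrite -[RHS]mul1r.
  apply: (@oriented_derivativeE _ _ G u j i (val0 w j) 0 1) => //.
  - by rewrite lexx l0.
  - move=> y /andP[y0 _]; rewrite gt_eqF// subr0 mul1r ger0_norm//.
    exact: ltW.
  - exact: mulr1.
  - exact: derive_val0.
rewrite -mulN1r.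
apply: (@oriented_derivativeE _ _ G u j i (val0 w j) (len j) (-1)) => //.
- by rewrite lexx l0.
- move=> y /andP[_ yl]; rewrite lt_eqF// mulN1r ler0_norm//.
  by rewrite subr_le0 ltW.
- by rewrite mulrNN mulr1.
- exact: derive_val0.
Qed.

Lemma second_derivative (f f1 f2 : R -> R) l :
  (forall y : R, 0 < y < l -> is_derive y 1 f (f1 y)) ->
  (forall y : R, 0 < y < l -> is_derive y 1 f1 (f2 y)) ->
  forall y, 0 < y < l -> f^`(2)%classic y = f2 y.
Proof.
move=> df df1 y yl; rewrite derive1nS derive1n1 derive1E.
have [_ <-] := df1 y yl; apply: near_eq_derive.
have : \forall z \near y, z \in `]0, l[ by apply: near_in_itvoo; rewrite in_itv.
apply: filterS => z; rewrite in_itv/= => /df dz.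
by rewrite derive1E; have [_ ->] := dz.
Qed.

(** A function of class C^2 on the network, as a function on the metric graph:
    its second derivative is extended by constants and integrated twice. *)
Lemma c2fun_of_network u : network_C2 G u -> exists w : c2net,
  [/\ forall j y, 0 <= y <= len j -> on_edge u j y = val0 w j y &
      forall j y, 0 < y < len j -> (on_edge u j)^`(2)%classic y = val2 w j y].
Proof.
move=> [_ C2].
have /choice[f1 /choice[f2 fP]] : forall j, exists f1, exists f2 : R -> R,
    [/\ {within `[0, len j], continuous (on_edge u j)},
        {within `[0, len j], continuous f1},
        {within `[0, len j], continuous f2},
        (forall y : R, 0 < y < len j -> is_derive y 1 (on_edge u j) (f1 y)) &
        (forall y : R, 0 < y < len j -> is_derive y 1 f1 (f2 y))].
  by move=> j; have [g1 [g2 gP]] := C2 j; exists g1, g2.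
pose g2 j y := f2 j (clamp (len j) y).
have cg2 j : continuous (g2 j).
  by have [_ _ cf2 _ _] := fP j; exact: continuous_clampf.
pose g1 j y := primitive (g2 j) y + f1 j 0.
have dg1 j (y : R) : is_derive y 1 (g1 j) (g2 j y).
  rewrite /g1 -[f1 j 0]opprK; apply: is_derive_subc.
  exact: is_derive_primitive.
have cg1 j : continuous (g1 j) by move=> y; exact: is_derive_continuous (dg1 j y).
pose g j y := primitive (g1 j) y + on_edge u j 0.
have dg j (y : R) : is_derive y 1 (g j) (g1 j y).
  rewrite /g -[on_edge u j 0]opprK; apply: is_derive_subc.
  exact: is_derive_primitive.
have cg j : continuous (g j) by move=> y; exact: is_derive_continuous (dg j y).
have e1 j y : 0 <= y <= len j -> f1 j y = g1 j y.
  have [_ cf1 _ _ df1] := fP j.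
  apply: (@eq_of_derive_oo _ (f1 j) (g1 j) (f2 j)) => //.
  - exact: continuous_subspaceT.
  - move=> z zl; have -> : f2 j z = g2 j z; last exact: dg1.
    by rewrite /g2 clamp_id//; case/andP: zl => *; rewrite !ltW.
  - by rewrite /g1 primitive0// add0r.
have e0 j y : 0 <= y <= len j -> on_edge u j y = g j y.
  have [cf _ _ df _] := fP j.
  apply: (@eq_of_derive_oo _ (on_edge u j) (g j) (f1 j)) => //.
  - exact: continuous_subspaceT.
  - move=> z zl; rewrite e1; first exact: dg.
    by case/andP: zl => *; rewrite !ltW.
  - by rewrite /g primitive0// add0r.
have vs j : g j 0 = u (src j) by rewrite -e0// lexx l0.
have vt j : g j (len j) = u (tgt j) by rewrite -e0// lexx l0.
exists (C2fun dg dg1 cg2 vs vt); split => [j y yl|j y yl] /=; first exact: e0.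
have [_ _ _ df df1] := fP j.
have -> : g2 j y = f2 j y.
  by rewrite /g2 clamp_id//; case/andP: yl => *; rewrite !ltW.
exact: second_derivative df df1 y yl.
Qed.

(** Conversely, a function on the metric graph defines a function of the points
    of the network, as it is single-valued at the vertices. *)
Lemma network_function_of_c2fun (w : c2net) :
  exists u, forall j y, 0 <= y <= len j -> on_edge u j y = val0 w j y.
Proof.
have wend j y : y = 0 \/ y = len j -> val0 w j y = valV w (par j y).
  by move=> [->|->]; [exact: val_src|exact: val_tgt].
have wE j k y z : 0 <= y <= len j -> 0 <= z <= len k -> par j y = par k z ->
    val0 w j y = val0 w k z.
  move=> yl zl yz; have [[jk ->]|[ye ze]] := par_eq yl zl yz; first by rewrite jk.
  by rewrite !wend// yz.
have /choice[u uP] : forall x, exists r : R, forall j y, 0 <= y <= len j ->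
    par j y = x -> r = val0 w j y.
  move=> x; have [[j [y [yl yx]]]|nx] := pselect (exists j y,
    0 <= y <= len j /\ par j y = x).
    exists (val0 w j y) => k z zl zx; apply: wE => //.
    by rewrite yx zx.
  by exists 0 => k z zl zx; exfalso; apply: nx; exists k, z.
by exists u => j y yl; exact: uP.
Qed.

Lemma network_C2_of_c2fun u (w : c2net) :
  (forall j y, 0 <= y <= len j -> on_edge u j y = val0 w j y) ->
  network_C2 G u /\ forall j y, 0 < y < len j ->
    (on_edge u j)^`(2)%classic y = val2 w j y.
Proof.
move=> uw.
have cu j : {within `[0, len j], continuous (on_edge u j)}.
  apply: (@subspace_eq_continuous _ _ _ (val0 w j)).
    by move=> y; rewrite inE/= in_itv/= => /uw.
  by apply: continuous_subspaceT; exact: continuous_val0.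
have du j y : 0 < y < len j -> is_derive y 1 (on_edge u j) (val1 w j y).
  move=> yl; apply: (@near_eq_is_derive _ _ _ (val0 w j)); last exact: derive_val0.
  have : \forall z \near y, z \in `]0, len j[.
    by apply: near_in_itvoo; rewrite in_itv.
  apply: filterS => z; rewrite in_itv/= => /andP[z0 zl].
  by rewrite uw// !ltW.
have dw j y : 0 < y < len j -> is_derive y 1 (val1 w j) (val2 w j y).
  by move=> _; exact: derive_val1.
split; last by move=> j y yl; exact: second_derivative (du j) (dw j) y yl.
split.
  split=> // i j k ij ik.
  have vE m : incident i m -> vertex_value u m i = u (vert i).
    move=> /orP[]/eqP e; rewrite /vertex_value /on_edge e edge_coordK//.
      by rewrite lexx l0.
    by rewrite lexx l0.
  by rewrite !vE.
move=> j; exists (val1 w j), (val2 w j); split => //.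
- by apply: continuous_subspaceT; exact: continuous_val1.
- by apply: continuous_subspaceT; exact: continuous_val2.
- exact: du.
- exact: dw.
Qed.

End Bridge.

(** * Solvability *)

Theorem theorem3p1 (R : realType) (n : nat) (G : network R n)
  (G_connected : connected (network_support G))
  (h : 'rV[R]_n -> R)
  (h_continuous : network_continuous G h)
  (h_neq0 : exists2 x, network_support G x & h x != 0) :
  (exists u : 'rV[R]_n -> R, kazdan_warner0_solution G h u) <->
  (changes_sign G h /\ network_integral G h < 0).
Proof.
have [ch _] := h_continuous.
pose H : edge G -> R -> R := clamped_edge h.
have cH j : continuous (H j) by exact: continuous_clamped_edge.
have lgt := @len_gt0 _ _ G.
have HE j y : 0 < y < len j -> H j y = h (par j y).
  by case/andP=> *; rewrite /H clamped_edgeE// !ltW.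
have supp (j : edge G) y : 0 < y < len j -> network_support G (par j y).
  by move=> yl; right; exists j => //; exists y => //=; rewrite in_itv.
rewrite network_integralE//.
split=> [[u [uC2 equ _ ku]]|[[[x Zx hx] _] Hneg]].
  have [w [uw uw2]] := c2fun_of_network uC2.
  have eqw j y : 0 < y < len j -> val2 w j y = - (H j y * expR (val0 w j y)).
    move=> yl; rewrite -uw2// equ// HE// uw//.
    by case/andP: yl => *; rewrite !ltW.
  have kw : kirchhoff (fun j => par j 0) (fun j => par j (len j))
      (@len _ _ G) (val1 w).
    apply/kirchhoffP => i; rewrite -[RHS](ku i); apply: eq_bigr => j ij.
    by rewrite (oriented_derivative_end (uw j) ij).
  have H_neq0 : exists j y, 0 < y < len j /\ H j y != 0.
    have [x Zx hx] := h_neq0.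
    have [j [y [yl yx]]] := support_on_edge G_connected Zx.
    have [||z zl] := @interior_pos _ (fun y => H j y * H j y) (len j) y _ (lgt j) yl.
    - exact: continuous_mulf.
    - by rewrite /H clamped_edgeE// yx -expr2 exprn_even_gt0.
    - move=> Hz; exists j, z; split => //; apply/eqP => Hz0.
      by move: Hz; rewrite Hz0 mulr0 ltxx.
  split; last first.
    exact: (@graph_integral_coef_lt0 _ _ _ _ _ _ lgt H w cH eqw kw H_neq0).
  have [j [y [yl Hy]]] := @rhs_pos _ _ _ _ _ _ lgt H w cH eqw kw H_neq0.
  have [k [z [zl Hz]]] := @rhs_neg _ _ _ _ _ _ lgt H w cH eqw kw H_neq0.
  by split; [exists (par j y)|exists (par k z)]; rewrite -?HE//; exact: supp.
have H_pos : exists j y, 0 < y < len j /\ 0 < H j y.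
  have [j [y [yl yx]]] := support_on_edge G_connected Zx.
  have [||z zl Hz] := @interior_pos _ (H j) (len j) y _ (lgt j) yl.
  - exact: cH.
  - by rewrite /H clamped_edgeE// yx.
  - by exists j, z.
have [w [eqw kw]] := kazdan_warner_existence lgt
  (network_connected G_connected) cH H_pos Hneg.
have [u uw] := network_function_of_c2fun w.
have [uC2 uw2] := network_C2_of_c2fun uw.
exists u; split => //.
- move=> j y yl; rewrite uw2// eqw// HE// uw//.
  by case/andP: yl => *; rewrite !ltW.
- by have [[_ ?] _] := uC2.
- move=> i; rewrite -[RHS](iffLR (kirchhoffP _) kw i); apply: eq_bigr => j ij.
  exact: oriented_derivative_end (uw j) ij.
Qed.
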